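(* Let $F^{\bullet}$ be a chain complex of finitely-generated free $2$-parameter persistence modules over $k=\mathbb{Z}_2$, together with an ordered basis for each $F^{n}$, and let $G^{\bullet}$ be the chain complex of finitely-generated free persistence modules returned by performing the algorithm multi-chunk on $F^{\bullet}$. Then $F^{\bullet}$ and $G^{\bullet}$ are homotopy equivalent.
   Context: **Persistence modules.** Let $k=\mathbb{Z}_2$ and let $\mathbb{Z}^2$ carry the product partial order. A ($2$-parameter) persistence module is a functor $M:\mathbb{Z}^2\to \mathrm{Vec}_k$; homomorphisms are natural transformations. An element $v\in M_{\mathbf z}$ has grade $\mathrm{gr}(v)=\mathbf z$. For $\mathbf u\in\mathbb{Z}^2$, $E^{\mathbf u}$ is the module with $E^{\mathbf u}_{\mathbf z}=k$ if $\mathbf u\le \mathbf z$ and $0$ otherwise, with identity maps between nonzero spaces. A module is free if it is isomorphic to a direct sum of modules $E^{\mathbf u}$; a basis is a minimal set of homogeneous generators. **Chain complexes.** A chain complex $F^\bullet$ of free persistence modules is a diagram $\cdots\xrightarrow{\partial^2}F^1\xrightarrow{\partial^1}F^0$ of free modules with $\partial^i\circ\partial^{i+1}=0$ (put $\partial^0=0$). Chain maps are families of homomorphisms $f^i$ commuting with the boundaries. Chain maps $f,g:F^\bullet\to G^\bullet$ are chain-homotopic if there are homomorphisms $h^n:F^n\to G^{n+1}$ with $\partial^{n+1}h^n+h^{n-1}\partial^n=f^n-g^n$ for all $n\ge 0$. $F^\bullet$ and $G^\bullet$ are homotopy equivalent if there are chain maps $f:F^\bullet\to G^\bullet$, $g:G^\bullet\to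 F^\bullet$ with $f\circ g$ chain-homotopic to $\mathrm{id}_{G^\bullet}$ and $g\circ f$ chain-homotopic to $\mathrm{id}_{F^\bullet}$. **Graded matrices.** The input $F^\bullet$ has only finitely many nonzero terms. Each $F^n$ has an ordered basis $B^n$ whose order is compatible with grades: if $\mathrm{gr}(g_1)<\mathrm{gr}(g_2)$ then $g_1$ precedes $g_2$. The boundary $\partial^n$ is represented by a graded matrix whose columns correspond to $B^n$, whose rows correspond to $B^{n-1}$ (in these orders), each row and column being annotated by the grade of its generator. The index $i(c)$ of a column $c$ is its position. The boundary of a column is the set of generators (row indices) with nonzero entry in it. The pivot of a nonzero column is its largest row index with nonzero entry. If the grade of the pivot equals the grade of the column, the pivot is called the local pivot of the column (and otherwise the column has no local pivot). Columns are identified with the corresponding generators. **The algorithm multi-chunk.** *Phase I (local reduction).* Process the matrices of $\partial^n$ in decreasing order of $n$. For a given $n$, traverse the columns in increasing index. If column $c$ is already labeled, do nothing. Otherwise, as long as $c$ has a local pivot and there is a column $c'$ with $i(c')<i(c)$ with the same local pivot as $c$, perform the column addition $c\leftarrow c+c'$. If at the end $c$ has no local pivot, label $c$ as global. Otherwise label $c$ as local negative and its local pivot $c''\in B^{n-1}$ as local positive. (All elements of $B^0$ not labeled local positive are global.) *Phase II (compression).* For each $n$ and each global column $c$ of the matrix of $\partial^n$: while the boundary of $c$ contains a local (positive or negative) generator, let $c'$ be the one of maximal index. If $c'$ is local negative, remove $c'$ from the boundary of $c$ (set the entry to $0$). If $c'$ is local positive, let $c''$ be the unique local negative $n$-column with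 local pivot $c'$, and perform $c\leftarrow c+c''$. *Phase III (removal).* In all matrices, remove all columns and all rows labeled local (positive or negative). The resulting matrices represent the boundary maps $\partial^n:G^n\to G^{n-1}$ of the output $G^\bullet$, where $G^n$ is the free module with basis $C^n\subseteq B^n$, the set of global generators, with their original grades.
   Formalization: In Phase I the column c' added to c is required to be already labeled local negative; if an unreduced local positive column with the same local pivot may be added, the output need not be a chain complex. *)

(* Defs.v *)
From HB Require Import structures.
From mathcomp Require Import all_boot all_order all_algebra.

Set Implicit Arguments.
Unset Strict Implicit.
Unset Printing Implicit Defensive.

Import Order.TTheory GRing.Theory.
Local Open Scope ring_scope.

(* [int *p int] is the library's alias of [int * int] carrying the product
   order: [(u <= v)%O] is [(u.1 <= v.1) && (u.2 <= v.2)], and [(u < v)%O] is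
   [u <= v] together with [u != v]. *)
Notation grade := (int *p int)%type.

(* ------------------------------------------------------------------ *)
(* Persistence modules                                                  *)

Record pmod := PMod {
  pm_obj :> grade -> lmodType 'F_2;
  pm_map : forall u v : grade, (u <= v)%O -> {linear pm_obj u -> pm_obj v};
  pm_map_id : forall (u : grade) (h : (u <= u)%O) (x : pm_obj u),
    pm_map h x = x;
  pm_map_comp : forall (u v w : grade)
      (huv : (u <= v)%O) (hvw : (v <= w)%O) (huw : (u <= w)%O) (x : pm_obj u),
    pm_map huw x = pm_map hvw (pm_map huv x)
}.

Record pmod_hom (M N : pmod) := PModHom {
  hom_fun :> forall z : grade, {linear M z -> N z};
  hom_nat : forall (u v : grade) (h : (u <= v)%O) (x : M u),
    hom_fun v (pm_map M h x) = pm_map N h (hom_fun u x)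
}.

Definition hom_id (M : pmod) : pmod_hom M M.
Proof. by exists (fun z => idfun : {linear M z -> M z}). Defined.

Definition hom_comp (M N P : pmod) (f : pmod_hom N P) (g : pmod_hom M N) :
  pmod_hom M P.
Proof.
exists (fun z => (f z \o g z) : {linear M z -> P z}).
by move=> u v h x /=; rewrite !hom_nat.
Defined.

Definition pmod_iso (M N : pmod) : Prop :=
  exists (f : pmod_hom M N) (g : pmod_hom N M),
    (forall z (x : M z), g z (f z x) = x) /\
    (forall z (y : N z), f z (g z y) = y).

Definition pmod_is_zero (M : pmod) : Prop := forall z (x : M z), x = 0.

(* The module E^u: the boolean [u <= z], read as 0 or 1, is the dimension of
   its value at z, and the structure map from z to w is the 1 x 1 identity
   matrix as soon as both values are nonzero. *)
Section Interval.
Variable u : grade.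

Let E_obj (z : grade) : lmodType 'F_2 := 'rV['F_2]_((u <= z)%O : bool).

Let E_map (z w : grade) (_ : (z <= w)%O) : {linear E_obj z -> E_obj w} :=
  mulmxr (const_mx 1 : 'M['F_2]_((u <= z)%O : bool, (u <= w)%O : bool)).

Fact pm_E_id (z : grade) (h : (z <= z)%O) (x : E_obj z) : E_map h x = x.
Proof.
move: x; rewrite /E_map /E_obj /=; case: (u <= z)%O => /= x.
  by apply/rowP=> j; rewrite mxE big_ord1 mxE mulr1 [j]ord1.
by apply/rowP; case.
Qed.

Fact pm_E_comp (z w t : grade) (hzw : (z <= w)%O) (hwt : (w <= t)%O)
  (hzt : (z <= t)%O) (x : E_obj z) : E_map hzt x = E_map hwt (E_map hzw x).
Proof.
have uzw : (u <= z)%O -> (u <= w)%O by move=> uz; apply: le_trans hzw.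
move: x uzw; rewrite /E_map /E_obj /= -/E_obj => x uzw.
rewrite -mulmxA; congr (_ *m _); apply/matrixP=> i j; rewrite !mxE.
under eq_bigr => l _ do rewrite !mxE mulr1.
have uz : (u <= z)%O by move: i {x uzw}; case: (u <= z)%O => // -[].
by rewrite sumr_const card_ord uzw.
Qed.

Definition pm_E : pmod := PMod pm_E_id pm_E_comp.

End Interval.

Definition pm_zero : pmod.
Proof.
exists (fun=> 'rV['F_2]_0 : lmodType 'F_2)
       (fun u v _ => idfun : {linear 'rV['F_2]_0 -> 'rV['F_2]_0}) => //.
Defined.

Section DirectSum.
Variables M N : pmod.

Let dsum_obj (z : grade) : lmodType 'F_2 := (M z * N z)%type.

Let dsum_fun (z w : grade) (h : (z <= w)%O) (x : dsum_obj z) : dsum_obj w :=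
  (pm_map M h x.1, pm_map N h x.2).

Fact pm_dsum_linear (z w : grade) (h : (z <= w)%O) : linear (dsum_fun h).
Proof. by move=> a x y; rewrite /dsum_fun /= !linearP. Qed.

Let dsum_map (z w : grade) (h : (z <= w)%O) :
  {linear dsum_obj z -> dsum_obj w} :=
  HB.pack (dsum_fun h)
    (GRing.isLinear.Build 'F_2 (dsum_obj z) (dsum_obj w) *:%R (dsum_fun h)
       (pm_dsum_linear h)).

Fact pm_dsum_id (z : grade) (h : (z <= z)%O) (x : dsum_obj z) :
  dsum_map h x = x.
Proof. by case: x => a b; rewrite /= /dsum_fun !pm_map_id. Qed.

Fact pm_dsum_comp (z w t : grade) (hzw : (z <= w)%O) (hwt : (w <= t)%O)
  (hzt : (z <= t)%O) (x : dsum_obj z) :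
  dsum_map hzt x = dsum_map hwt (dsum_map hzw x).
Proof.
by rewrite /= /dsum_fun /= (pm_map_comp hzw hwt) (pm_map_comp hzw hwt).
Qed.

Definition pm_dsum : pmod := PMod pm_dsum_id pm_dsum_comp.

End DirectSum.

Definition pm_free (s : seq grade) : pmod :=
  foldr (fun u M => pm_dsum (pm_E u) M) pm_zero s.

Definition fg_free (M : pmod) : Prop :=
  exists s : seq grade, pmod_iso M (pm_free s).

(* The image of x : M u in M z when u <= z, and 0 otherwise. *)
Definition pm_push (M : pmod) (u z : grade) (x : M u) : M z :=
  match @idP (u <= z)%O with
  | ReflectT h => pm_map M h x
  | ReflectF _ => 0
  end.

Section Bases.
Variables (M : pmod) (r : nat) (gr : 'I_r -> grade).
Variable b : forall i : 'I_r, M (gr i).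

Definition generates (S : {set 'I_r}) : Prop :=
  forall (z : grade) (x : M z), exists c : 'I_r -> 'F_2,
    x = \sum_(i in S | (gr i <= z)%O) c i *: pm_push z (b i).

Definition is_basis : Prop :=
  generates [set: 'I_r] /\ forall S, generates S -> S = [set: 'I_r].

End Bases.

(* ------------------------------------------------------------------ *)
(* Chain complexes                                                      *)

(* [bd n] is the boundary from degree n.+1 to degree n. *)
Record chain_complex := ChainComplex {
  ch :> nat -> pmod;
  bd : forall n, pmod_hom (ch n.+1) (ch n);
  bd_bd : forall n z (x : ch n.+2 z), bd n z (bd n.+1 z x) = 0
}.

Record chain_map (F G : chain_complex) := ChainMap {
  cm_fun :> forall n, pmod_hom (F n) (G n);
  cm_bd : forall n z (x : F n.+1 z),
    cm_fun n z (bd F n z x) = bd G n z (cm_fun n.+1 z x)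
}.

Definition cm_id (F : chain_complex) : chain_map F F.
Proof. by exists (fun n => hom_id (F n)). Defined.

Definition cm_comp (F G H : chain_complex)
  (f : chain_map G H) (g : chain_map F G) : chain_map F H.
Proof.
exists (fun n => hom_comp (f n) (g n)).
by move=> n z x /=; rewrite !cm_bd.
Defined.

(* In degree 0 the term involving the zero boundary out of F 0 is absent. *)
Definition chain_homotopic (F G : chain_complex) (f g : chain_map F G) : Prop :=
  exists h : forall n, pmod_hom (F n) (G n.+1),
    (forall z (x : F 0 z), bd G 0 z (h 0 z x) = f 0 z x - g 0 z x) /\
    (forall n z (x : F n.+1 z),
       bd G n.+1 z (h n.+1 z x) + h n z (bd F n z x)
       = f n.+1 z x - g n.+1 z x).

Definition homotopy_equivalent (F G : chain_complex) : Prop :=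
  exists (f : chain_map F G) (g : chain_map G F),
    chain_homotopic (cm_comp f g) (cm_id G) /\
    chain_homotopic (cm_comp g f) (cm_id F).

(* ------------------------------------------------------------------ *)
(* Graded matrices                                                      *)

(* [gm_bd n] is the matrix of the boundary from degree n.+1 to degree n: its
   columns are indexed by the generators of degree n.+1, its rows by those of
   degree n. *)
Record graded_matrices := GradedMatrices {
  gm_rank : nat -> nat;
  gm_gr : forall n, 'I_(gm_rank n) -> grade;
  gm_bd : forall n, 'M['F_2]_(gm_rank n, gm_rank n.+1)
}.

Definition order_compatible (D : graded_matrices) : Prop :=
  forall n (i j : 'I_(gm_rank D n)),
    (gm_gr i < gm_gr j)%O -> (i < j)%N.

Definition ordered_bases (F : chain_complex) (D : graded_matrices) : Type :=
  forall n (i : 'I_(gm_rank D n)), F n (gm_gr i).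

Definition represented_by (F : chain_complex) (D : graded_matrices)
    (B : ordered_bases F D) : Prop :=
  [/\ forall n, fg_free (F n),
      forall n, is_basis (B n),
      forall n (i : 'I_(gm_rank D n)) (j : 'I_(gm_rank D n.+1)),
        gm_bd D n i j != 0 -> (gm_gr i <= gm_gr j)%O
    & forall n (j : 'I_(gm_rank D n.+1)),
        bd F n (gm_gr j) (B n.+1 j)
        = \sum_(i | (gm_gr i <= gm_gr j)%O)
            gm_bd D n i j *: pm_push (gm_gr j) (B n i)].

(* ------------------------------------------------------------------ *)
(* The algorithm                                                        *)

(* In this section [rgr] and [cgr] are the grades of the rows and columns of
   the matrix being processed. A labelling is given by two sets: the local
   positive and the local negative generators; all others are global. *)
Section OneMatrix.
Variables (m n : nat) (rgr : 'I_m -> grade) (cgr : 'I_n -> grade).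
Implicit Types (A : 'M['F_2]_(m, n)) (c : 'I_n).

Definition pivot A c : option 'I_m :=
  [pick i | (A i c != 0) && [forall i', (A i' c != 0) ==> (i' <= i)%N]].

Definition local_pivot A c : option 'I_m :=
  if pivot A c is Some i then if rgr i == cgr c then Some i else None
  else None.

Definition add_col c c' A : 'M['F_2]_(m, n) :=
  \matrix_(i, j) (if j == c then A i c + A i c' else A i j).

Definition clear_entry (i : 'I_m) c A : 'M['F_2]_(m, n) :=
  \matrix_(i', j) (if (i' == i) && (j == c) then 0 else A i' j).

Record reduction_state := ReductionState {
  rs_mx : 'M['F_2]_(m, n);
  rs_neg : {set 'I_n};  (* columns labelled local negative so far *)
  rs_pos : {set 'I_m}   (* rows labelled local positive so far *)
}.

(* The column c' that is added to c ranges over the columns already labelled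
   local negative. Columns labelled local positive are skipped, hence never
   reduced, and are not used for additions: adding them instead can produce
   matrices whose consecutive products are not zero. *)
Definition reduce_step (neg : {set 'I_n}) c A : 'M['F_2]_(m, n) :=
  if [pick c' in neg | [&& (c' < c)%N, local_pivot A c != None
                         & local_pivot A c' == local_pivot A c]] is Some c'
  then add_col c c' A else A.

(* Each addition strictly decreases the pivot of c, so that m iterations
   exhaust the while loop. *)
Definition visit (pos : {set 'I_n}) (st : reduction_state) c :
    reduction_state :=
  if c \in pos then st else
  let A := iter m (reduce_step (rs_neg st) c) (rs_mx st) in
  if local_pivot A c is Some i
  then ReductionState A (c |: rs_neg st) (i |: rs_pos st)
  else ReductionState A (rs_neg st) (rs_pos st).

(* [pos] is the set of columns labelled local positive beforehand. The
   sequence [enum 'I_n] is increasing. *)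
Definition local_reduction (pos : {set 'I_n}) A : reduction_state :=
  foldl (visit pos) (ReductionState A set0 set0) (enum 'I_n).

(* [rpos], [rneg] are the local positive and negative rows, [cneg] the local
   negative columns. *)
Definition compress_step (rpos rneg : {set 'I_m}) (cneg : {set 'I_n}) c A :
    'M['F_2]_(m, n) :=
  let in_bd i := (A i c != 0) && (i \in rpos :|: rneg) in
  if [pick i | in_bd i && [forall i', in_bd i' ==> (i' <= i)%N]] is Some i
  then if i \in rneg then clear_entry i c A
       else if [pick c' in cneg | local_pivot A c' == Some i] is Some c'
            then add_col c c' A else A
  else A.

(* Each step strictly decreases the maximal local index in the boundary of c,
   so that m iterations exhaust the while loop. *)
Definition compress (rpos rneg : {set 'I_m}) (cpos cneg : {set 'I_n}) A :
    'M['F_2]_(m, n) :=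
  foldl (fun A' c => iter m (compress_step rpos rneg cneg c) A') A
        [seq c <- enum 'I_n | c \notin cpos :|: cneg].

End OneMatrix.

Section MultiChunk.
(* All generators are assumed to have degree at most N. *)
Variables (N : nat) (D : graded_matrices).

(* The local positive generators of degree n: they are determined by the
   reduction of [gm_bd D n], which uses the local positive generators of degree
   n.+1. The first argument counts the matrices that precede, in the decreasing
   order of degrees, the one to be visited. *)
Fixpoint positives_rec (fuel n : nat) : {set 'I_(gm_rank D n)} :=
  if fuel is fuel'.+1 then
    rs_pos (local_reduction (@gm_gr D n) (@gm_gr D n.+1)
              (positives_rec fuel' n.+1) (gm_bd D n))
  else set0.

Definition positives (n : nat) : {set 'I_(gm_rank D n)} :=
  positives_rec (N - n) n.

Definition phase1 (n : nat) : reduction_state (gm_rank D n) (gm_rank D n.+1) :=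
  local_reduction (@gm_gr D n) (@gm_gr D n.+1) (positives n.+1) (gm_bd D n).

Definition negatives (n : nat) : {set 'I_(gm_rank D n)} :=
  match n with
  | 0 => set0
  | n'.+1 => rs_neg (phase1 n')
  end.

Definition phase2 (n : nat) : 'M['F_2]_(gm_rank D n, gm_rank D n.+1) :=
  compress (@gm_gr D n) (@gm_gr D n.+1)
    (positives n) (negatives n) (positives n.+1) (negatives n.+1)
    (rs_mx (phase1 n)).

Definition globals (n : nat) : {set 'I_(gm_rank D n)} :=
  ~: (positives n :|: negatives n).

(* [enum_val] lists the global generators in increasing index order. *)
Definition multi_chunk : graded_matrices :=
  @GradedMatrices
    (fun n => #|globals n|)
    (fun n i => gm_gr (enum_val i))
    (fun n => mxsub enum_val enum_val (phase2 n)).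

End MultiChunk.

(* Main.v *)
(** Phase I makes the block of the boundary [d] with local positive rows and
    local negative columns triangular with ones at the pivots, so this block
    has an inverse that respects grades; extended by zero it is a map [h] of
    degree one with [h h = 0] and [h d h = h].  Therefore [1 - d h - h d] is an
    idempotent chain map homotopic to the identity; restricting to the global
    generators before and after it gives mutually inverse homotopy
    equivalences, for the boundary [d - d h d] on the global generators.  This
    Schur complement is what Phase II computes: both phases change a global
    column only by adding local negative columns, and the stale rows of local
    negative generators are discarded.  Matrices may be used instead of modules
    because a minimal generating set of a free module is linearly
    independent. *)

From HB Require Import structures.
Require Import Defs.
From mathcomp Require Import all_boot all_order all_algebra.

Set Implicit Arguments.
Unset Strict Implicit.
Unset Printing Implicit Defensive.

Import Order.TTheory GRing.Theory.
Local Open Scope ring_scope.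

Lemma F2_neq0 (x : 'F_2) : x != 0 -> x = 1.
Proof. by case: x => [[|[|[]]] //= i] _; apply/val_inj. Qed.

Lemma F2_addxx (x : 'F_2) : x + x = 0.
Proof. by apply/val_inj; case: x => [[|[|[]]]]. Qed.

(** * Free modules and graded matrices *)

Section Push.
Variable M : pmod.

Lemma pm_pushE (u z : grade) (h : (u <= z)%O) (x : M u) :
  pm_push z x = pm_map M h x.
Proof.
rewrite /pm_push; case: {-}_ / idP => [h'|//].
by rewrite (bool_irrelevance h' h).
Qed.

Lemma pm_push0 (u z : grade) (x : M u) : ~~ (u <= z)%O -> pm_push z x = 0.
Proof. by rewrite /pm_push; case: {-}_ / idP => // h; rewrite h. Qed.

Lemma pm_push_id (u : grade) (x : M u) : pm_push u x = x.
Proof. by rewrite (pm_pushE (lexx u)) pm_map_id. Qed.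

Lemma pm_map_push (u v z : grade) (h : (v <= z)%O) (x : M u) :
  (u <= v)%O -> pm_map M h (pm_push v x) = pm_push z x.
Proof.
move=> uv; rewrite (pm_pushE uv) (pm_pushE (le_trans uv h)).
by rewrite (pm_map_comp uv h).
Qed.

Lemma pm_push_push (u v z : grade) (x : M u) :
  (u <= v)%O -> (v <= z)%O -> pm_push z (pm_push v x) = pm_push z x.
Proof. by move=> uv vz; rewrite (pm_pushE vz) pm_map_push. Qed.

End Push.

Lemma hom_push (M N : pmod) (f : pmod_hom M N) (u z : grade) (x : M u) :
  f z (pm_push z x) = pm_push z (f u x).
Proof.
have [uz|uz] := boolP (u <= z)%O; first by rewrite !(pm_pushE uz) hom_nat.
by rewrite !pm_push0 // linear0.
Qed.

(** These are the matrices of homomorphisms between free modules: a nonzero map from E^v to E^u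
    exists only when u <= v. *)
Definition graded m n (rgr : 'I_m -> grade) (cgr : 'I_n -> grade)
    (X : 'M['F_2]_(m, n)) : bool :=
  [forall i, forall j, (X i j != 0) ==> (rgr i <= cgr j)%O].

Lemma gradedP m n (rgr : 'I_m -> grade) (cgr : 'I_n -> grade)
    (X : 'M['F_2]_(m, n)) :
  reflect (forall i j, X i j != 0 -> (rgr i <= cgr j)%O) (graded rgr cgr X).
Proof.
apply: (iffP forallP) => [H i j|H i]; last by apply/forallP => j; apply/implyP/H.
by move/forallP: (H i) => /(_ j)/implyP.
Qed.

Lemma graded1 n (gr : 'I_n -> grade) : graded gr gr 1%:M.
Proof.
apply/gradedP => i j; rewrite mxE; case: (eqVneq i j) => [->|] //=.
Qed.

Lemma gradedD m n (rgr : 'I_m -> grade) (cgr : 'I_n -> grade)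
    (X Y : 'M['F_2]_(m, n)) :
  graded rgr cgr X -> graded rgr cgr Y -> graded rgr cgr (X + Y).
Proof.
move=> /gradedP gX /gradedP gY; apply/gradedP => i j; rewrite mxE => nz.
have [X0|/gX//] := eqVneq (X i j) 0; apply: gY.
by apply: contraNneq nz => ->; rewrite X0 addr0.
Qed.

Lemma gradedN m n (rgr : 'I_m -> grade) (cgr : 'I_n -> grade)
    (X : 'M['F_2]_(m, n)) : graded rgr cgr X -> graded rgr cgr (- X).
Proof.
move=> /gradedP gX; apply/gradedP => i j; rewrite mxE oppr_eq0; exact: gX.
Qed.

Lemma gradedB m n (rgr : 'I_m -> grade) (cgr : 'I_n -> grade)
    (X Y : 'M['F_2]_(m, n)) :
  graded rgr cgr X -> graded rgr cgr Y -> graded rgr cgr (X - Y).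
Proof. by move=> gX gY; apply: gradedD => //; apply: gradedN. Qed.

Lemma gradedM m n p (g1 : 'I_m -> grade) (g2 : 'I_n -> grade)
    (g3 : 'I_p -> grade) (X : 'M['F_2]_(m, n)) (Y : 'M['F_2]_(n, p)) :
  graded g1 g2 X -> graded g2 g3 Y -> graded g1 g3 (X *m Y).
Proof.
move=> /gradedP gX /gradedP gY; apply/gradedP => i j; rewrite mxE => nz.
have [k XY|XY0] := pickP (fun k => X i k * Y k j != 0).
  move: XY; rewrite mulf_eq0 negb_or => /andP[/gX h1 /gY h2].
  exact: le_trans h1 h2.
by rewrite big1 ?eqxx // in nz => k _; apply/eqP; rewrite -[_ == _]negbK XY0.
Qed.

Lemma graded_sub m n m' n' (rgr : 'I_m -> grade) (cgr : 'I_n -> grade)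
    (f : 'I_m' -> 'I_m) (g : 'I_n' -> 'I_n) (X : 'M['F_2]_(m, n)) :
  graded rgr cgr X -> graded (rgr \o f) (cgr \o g) (mxsub f g X).
Proof. by move=> /gradedP gX; apply/gradedP => i j; rewrite mxE => /gX. Qed.

(** * Coordinates with respect to a free basis *)

Section Combinations.
Variables (M : pmod) (r : nat) (gr : 'I_r -> grade).
Variable b : forall i : 'I_r, M (gr i).

(** The sum can run over all generators because [pm_push] is 0 when its source grade is not below
    [z]; this makes [comb] linear without side conditions. *)
Definition comb (z : grade) (c : 'cV['F_2]_r) : M z :=
  \sum_i c i 0 *: pm_push z (b i).

(* [graded gr (fun=> z) c] says that the coordinate vector [c] involves only
   generators that exist at grade [z]. *)
Definition free_basis : Prop :=
  (forall z (x : M z), exists2 c, graded gr (fun=> z) c & comb z c = x) /\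
  (forall z c, graded gr (fun=> z) c -> comb z c = 0 -> c = 0).

Fact comb_linear z : linear (comb z).
Proof.
move=> a c d; rewrite /comb scaler_sumr -big_split /=; apply: eq_bigr => i _.
by rewrite !mxE scalerDl scalerA.
Qed.

HB.instance Definition _ z :=
  GRing.isLinear.Build 'F_2 'cV['F_2]_r (M z) *:%R (comb z) (@comb_linear z).

Lemma comb_le z c : comb z c = \sum_(i | (gr i <= z)%O) c i 0 *: pm_push z (b i).
Proof.
rewrite /comb (bigID (fun i => (gr i <= z)%O)) /= [X in _ + X]big1 ?addr0 //.
by move=> i iz; rewrite pm_push0 // scaler0.
Qed.

Lemma pm_map_comb u v (h : (u <= v)%O) c :
  graded gr (fun=> u) c -> pm_map M h (comb u c) = comb v c.
Proof.
move=> /gradedP gc; rewrite linear_sum /=; apply: eq_bigr => i _.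
rewrite linearZ /=; have [->|/gc iu] := eqVneq (c i 0) 0; first by rewrite !scale0r.
by rewrite pm_map_push.
Qed.

Lemma comb_delta i : comb (gr i) (delta_mx i 0) = b i.
Proof.
rewrite /comb (bigD1 i) //= big1 => [|j ji].
  by rewrite mxE !eqxx scale1r addr0 pm_push_id.
by rewrite mxE (negPf ji) scale0r.
Qed.

Lemma graded_delta i : graded gr (fun=> gr i) (delta_mx i 0 : 'cV_r).
Proof.
apply/gradedP => j k; rewrite mxE; by have [->|] := eqVneq j i.
Qed.

Lemma generatesP : generates b [set: 'I_r] <->
  (forall z (x : M z), exists2 c, graded gr (fun=> z) c & comb z c = x).
Proof.
split=> [gb z x|gb z x].
  have [c ->] := gb z x; exists (\col_i (if (gr i <= z)%O then c i else 0)).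
    by apply/gradedP => i j; rewrite mxE; case: ifP => //; rewrite eqxx.
  rewrite comb_le; apply: eq_big => [i|i iz]; first by rewrite inE.
  by rewrite mxE iz.
have [c _ <-] := gb z x; exists (fun i => c i 0).
by rewrite comb_le; apply: eq_bigl => i; rewrite inE.
Qed.

(** If a generating set omits [i], expressing [b i] through it yields a relation with coefficient 1
    at [i]. *)
Lemma free_basis_is_basis : free_basis -> is_basis b.
Proof.
move=> [gb ib]; split=> [|S gS]; first exact/generatesP.
apply/setP => i; rewrite inE; apply/idPn => iS.
have [c bE] := gS _ (b i).
pose d : 'cV_r := \col_j (if (j \in S) && (gr j <= gr i)%O then c j else 0).
have gd : graded gr (fun=> gr i) d.
  by apply/gradedP => j k; rewrite mxE; case: ifP => [/andP[]|].
have : delta_mx i 0 - d = 0.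
  apply: (ib (gr i)); first by apply: gradedB => //; apply: graded_delta.
  apply/eqP; rewrite linearB /= comb_delta subr_eq0 {1}bE /comb big_mkcond /=.
  apply/eqP/eq_bigr => j _; rewrite mxE.
  by case: ifP => _; rewrite ?scale0r.
move/colP => /(_ i); rewrite !mxE (negPf iS) !eqxx subr0 => /eqP.
by rewrite oner_eq0.
Qed.

End Combinations.

Section Coordinates.
Variables (M : pmod) (r : nat) (gr : 'I_r -> grade).
Variable b : forall i : 'I_r, M (gr i).
Hypothesis fb : free_basis b.

Fact coords_subproof z (x : M z) :
  exists c : 'cV_r, graded gr (fun=> z) c && (comb b z c == x).
Proof. by have [c gc <-] := fb.1 z x; exists c; rewrite gc eqxx. Qed.

Definition coords z (x : M z) : 'cV_r := xchoose (coords_subproof x).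

Lemma graded_coords z x : graded gr (fun=> z) (@coords z x).
Proof. by have /andP[] := xchooseP (coords_subproof x). Qed.

Lemma coordsK z : cancel (@coords z) (comb b z).
Proof. by move=> x; have /andP[_ /eqP] := xchooseP (coords_subproof x). Qed.

Lemma comb_inj z c d : graded gr (fun=> z) c -> graded gr (fun=> z) d ->
  comb b z c = comb b z d -> c = d.
Proof.
move=> gc gd E; apply/eqP; rewrite -subr_eq0; apply/eqP/(fb.2 z).
  exact: gradedB.
by rewrite linearB /= E subrr.
Qed.

Lemma combK z c : graded gr (fun=> z) c -> coords (comb b z c) = c.
Proof.
by move=> gc; apply: (@comb_inj z) => //; rewrite ?graded_coords ?coordsK.
Qed.

Lemma coords_basis i : coords (b i) = delta_mx i 0.
Proof. by rewrite -{1}(comb_delta b i) combK // graded_delta. Qed.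

Fact coords_linear z : linear (@coords z).
Proof.
move=> a x y; apply: (@comb_inj z); first exact: graded_coords.
  apply: gradedD; last exact: graded_coords.
  apply/gradedP => i j; rewrite mxE mulf_eq0 negb_or => /andP[_].
  exact/gradedP/graded_coords.
by rewrite linearP /= !coordsK.
Qed.

HB.instance Definition _ z :=
  GRing.isLinear.Build 'F_2 (M z) 'cV['F_2]_r *:%R (@coords z) (@coords_linear z).

Lemma coords_map u v (h : (u <= v)%O) (x : M u) :
  coords (pm_map M h x) = coords x.
Proof.
rewrite -{1}(coordsK x) pm_map_comb ?graded_coords // combK //.
apply/gradedP => i j /(gradedP _ _ _ (graded_coords x)) iu.
exact: le_trans iu h.
Qed.

End Coordinates.

Section HomOfMatrix.
Variables (M : pmod) (r : nat) (gr : 'I_r -> grade).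
Variable b : forall i : 'I_r, M (gr i).
Hypothesis fb : free_basis b.
Variables (N : pmod) (s : nat) (gr' : 'I_s -> grade).
Variable b' : forall i : 'I_s, N (gr' i).
Variable X : 'M['F_2]_(s, r).
Hypothesis gX : graded gr' gr X.

(** One matrix serves all grades, since structure maps leave coordinates unchanged. *)
Definition hom_mx_fun z (x : M z) : N z := comb b' z (X *m coords fb x).

Fact hom_mx_linear z : linear (@hom_mx_fun z).
Proof.
by move=> a x y; rewrite /hom_mx_fun linearP linearD /= -scalemxAr linearP.
Qed.

HB.instance Definition _ z :=
  GRing.isLinear.Build 'F_2 (M z) (N z) *:%R (@hom_mx_fun z) (@hom_mx_linear z).

Fact hom_mx_nat u v (h : (u <= v)%O) (x : M u) :
  hom_mx_fun (pm_map M h x) = pm_map N h (hom_mx_fun x).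
Proof.
rewrite /hom_mx_fun pm_map_comb ?coords_map //.
by apply: gradedM gX _; apply: graded_coords.
Qed.

Definition hom_mx : pmod_hom M N :=
  @PModHom M N (fun z => @hom_mx_fun z : {linear M z -> N z}) hom_mx_nat.

Lemma coords_hom_mx (fb' : free_basis b') z (x : M z) :
  coords fb' (hom_mx z x) = X *m coords fb x.
Proof. by rewrite combK // (gradedM gX) ?graded_coords. Qed.

End HomOfMatrix.

Lemma strict_idempotent_eq0 r (gr : 'I_r -> grade) (X : 'M['F_2]_r) :
  X *m X = X -> (forall i j, X i j != 0 -> (gr i < gr j)%O) -> X = 0.
Proof.
move=> XX sX; apply/matrixP => i j; rewrite mxE.
(* Induction on the number of generators of grade strictly below [gr j]: in a nonzero term
   [X i l * X l j] one has [gr l < gr j], so [X i l] vanishes by induction. *)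
have [k] := ubnP #|[set l | (gr l < gr j)%O]|.
elim: k => // k IH in i j * => lek.
rewrite -XX mxE big1 // => l _; have [->|/sX lj] := eqVneq (X l j) 0.
  by rewrite mulr0.
rewrite IH ?mul0r //; rewrite ltnS in lek; apply: leq_trans lek; apply: proper_card.
apply/properP; split; last by exists l; rewrite !inE ?ltxx.
by apply/subsetP => p; rewrite !inE => /lt_trans; apply.
Qed.

(** Used for changes of generators and, with [b] the boundaries of basis elements, to read off the
    matrix of a boundary map. *)
Lemma comb_trans (M : pmod) (r p : nat) (gr : 'I_r -> grade)
    (gr' : 'I_p -> grade) (b : forall i, M (gr i)) (e : forall k, M (gr' k))
    (P : 'M['F_2]_(p, r)) :
  graded gr' gr P -> (forall j, comb e (gr j) (col j P) = b j) ->
  forall z c, graded gr (fun=> z) c -> comb e z (P *m c) = comb b z c.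
Proof.
move=> gP bE z c /gradedP gc; rewrite {2}/comb.
have -> : P *m c = \sum_j c j 0 *: col j P.
  apply/colP => i; rewrite mxE summxE; apply: eq_bigr => j _.
  by rewrite !mxE mulrC.
rewrite linear_sum; apply: eq_bigr => j _; rewrite linearZ /=.
have [->|/gc jz] := eqVneq (c j 0) 0; first by rewrite !scale0r.
rewrite (pm_pushE jz) -bE pm_map_comb //.
by apply/gradedP => i k; rewrite mxE => /(gradedP _ _ _ gP).
Qed.

Section MinimalGenerators.
Variables (M : pmod) (r : nat) (gr : 'I_r -> grade).
Variable b : forall i : 'I_r, M (gr i).

(** A nonzero coefficient at the grade of [b i] itself would express [b i] through the other
    generators. The grade is a separate variable because in the application [z] is [gr j], only
    provably equal to [gr i]. *)
Lemma minimal_relation : is_basis b -> forall i z c, gr i = z ->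
  graded gr (fun=> z) c -> comb b z c = 0 -> c i 0 = 0.
Proof.
move=> [gb mb] i _ c <- gc c0; apply/eqP/idPn => /F2_neq0 ci.
have /mb/setP/(_ i) : generates b [set~ i]; last by rewrite !inE eqxx.
move=> z x; have /generatesP gb' := gb; have [d gd <-] := gb' z x.
have [iz|iz] := boolP (gr i <= z)%O; last first.
  exists (fun j => d j 0); rewrite comb_le; apply: eq_bigl => j.
  by rewrite !inE; case: eqP => [->|//]; rewrite (negPf iz).
(* Subtracting [d i 0] times the relation, pushed from [gr i] to [z], clears the coefficient of
   [i]. *)
exists (fun j => (d - d i 0 *: c) j 0).
have -> : comb b z d = comb b z (d - d i 0 *: c).
  rewrite linearB linearZ /=.
  by rewrite -(pm_map_comb b iz gc) c0 linear0 scaler0 subr0.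
rewrite comb_le big_mkcond [RHS]big_mkcond; apply: eq_bigr => j _.
rewrite !inE; have [->|//] := eqVneq j i.
by rewrite iz !mxE ci mulr1 subrr scale0r.
Qed.

(* Let [P] express the generators [b] in a linearly independent basis [e] and
   [Q] the other way round.  Then [P Q = 1], so that [1 - Q P] is idempotent;
   its columns are relations between the generators, and minimality makes it
   strictly graded, hence zero. *)
Lemma is_basis_free (p : nat) (gr' : 'I_p -> grade) (e : forall k, M (gr' k)) :
  free_basis e -> is_basis b -> free_basis b.
Proof.
move=> fe bb; have /generatesP gb := bb.1; split=> // z c gc c0.
pose P := \matrix_(k, j) coords fe (b j) k 0.
have gP : graded gr' gr P.
  by apply/gradedP => i j; rewrite mxE => /(gradedP _ _ _ (graded_coords _ _)).
have bP j : comb e (gr j) (col j P) = b j.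
  rewrite -[RHS](coordsK fe); congr (comb _ _ _).
  by apply/colP => i; rewrite !mxE.
have /fin_all_exists2[q gq eq] k := gb _ (e k).
pose Q := \matrix_(j, k) q k j 0.
have gQ : graded gr gr' Q.
  by apply/gradedP => i j; rewrite mxE => /(gradedP _ _ _ (gq j)).
have eQ k : comb b (gr' k) (col k Q) = e k.
  by rewrite -eq; congr (comb _ _ _); apply/colP => i; rewrite !mxE.
have PQ : P *m Q = 1%:M.
  apply/matrixP => i k.
  have gQk : graded gr (fun=> gr' k) (col k Q).
    by apply/gradedP => j l; rewrite mxE => /(gradedP _ _ _ gQ).
  have /colP/(_ i) : P *m col k Q = delta_mx k 0.
    apply: (comb_inj fe (gradedM gP gQk) (graded_delta _ _)).
    by rewrite (comb_trans gP bP) // eQ comb_delta.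
  by rewrite !colE mulmxA -colE !mxE andbT.
pose X := 1%:M - Q *m P.
have gX : graded gr gr X by apply: gradedB (graded1 _) (gradedM gQ gP).
have X0 : X = 0.
  apply: (@strict_idempotent_eq0 _ gr).
    rewrite /X mulmxBl mul1mx mulmxBr mulmx1 mulmxA -(mulmxA Q) PQ mulmx1.
    by rewrite subrr subr0.
  move=> i j Xij; rewrite lt_neqAle (gradedP _ _ _ gX) // andbT.
  apply: contraNneq Xij => ij.
  have gXj : graded gr (fun=> gr j) (col j X).
    by apply/gradedP => k l; rewrite mxE => /(gradedP _ _ _ gX).
  have <- : col j X i 0 = X i j by rewrite mxE.
  apply/eqP/(minimal_relation bb ij gXj).
  have -> : col j X = delta_mx j 0 - Q *m col j P.
    by rewrite linearB /= !colE mul1mx mulmxA.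
  rewrite linearB /= comb_delta (comb_trans gQ eQ) ?bP ?subrr //.
  by apply/gradedP => k l; rewrite mxE => /(gradedP _ _ _ gP).
(* Independence of [e] gives [P c = 0]; since [Q P = 1], also [c = Q P c = 0]. *)
have Pc : P *m c = 0.
  apply: (fe.2 z); first exact: gradedM gP gc.
  by rewrite (comb_trans gP bP).
have := mul1mx c; rewrite -[1%:M](subrK (Q *m P)) -/X X0 add0r -mulmxA Pc.
by rewrite mulmx0.
Qed.

End MinimalGenerators.

(** * Sums of interval modules and their standard bases *)

Lemma push0 (M : pmod) u z : pm_push z (0 : M u) = 0.
Proof.
have [uz|uz] := boolP (u <= z)%O; first by rewrite (pm_pushE uz) linear0.
exact: pm_push0.
Qed.

Lemma pm_push_dsum (M N : pmod) u z (x : pm_dsum M N u) :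
  pm_push z x = (pm_push z x.1, pm_push z x.2) :> pm_dsum M N z.
Proof.
have [uz|uz] := boolP (u <= z)%O; first by rewrite !(pm_pushE uz).
by rewrite !pm_push0.
Qed.

Definition pm_E_gen (u : grade) : pm_E u u :=
  (const_mx 1 : 'rV['F_2]_((u <= u)%O : bool)).

Lemma pm_E_spanned u z (x : pm_E u z) : exists a, a *: pm_push z (pm_E_gen u) = x.
Proof.
have [uz|uz] := boolP (u <= z)%O; last first.
  exists 0; rewrite scale0r; move: x; rewrite /= (negPf uz) => x.
  by apply/rowP; case.
(* Summing over the columns reads off the only entry without casting the dimension [(u <= z)] to
   1. *)
rewrite (pm_pushE uz); exists (\sum_j (x : 'rV_((u <= z)%O : bool)) 0 j).
apply/rowP => j; rewrite !mxE.
under [X in _ * X]eq_bigr => l _ do rewrite !mxE mulr1.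
rewrite sumr_const card_ord lexx mulr1.
move: x j; rewrite /= uz => x j.
by rewrite big_ord1 [j]ord1.
Qed.

Lemma pm_E_free u z a : (u <= z)%O -> a *: pm_push z (pm_E_gen u) = 0 -> a = 0.
Proof.
move=> uz; rewrite (pm_pushE uz) => /rowP E.
have lt : (0 < ((u <= z)%O : bool))%N by rewrite uz.
have := E (Ordinal lt); rewrite !mxE.
under [X in _ * X]eq_bigr => l _ do rewrite !mxE mulr1.
by rewrite sumr_const card_ord lexx mulr1.
Qed.

Definition grade0 : grade := (0, 0).

(** Indexing by [nat] keeps ordinal casts out of the recursion; past the end of the list the value
    is 0. *)
Fixpoint pm_free_gen (s : seq grade) (i : nat) : pm_free s (nth grade0 s i) :=
  match s, i return pm_free s (nth grade0 s i) with
  | [::], _ => 0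
  | u :: s', 0 => (pm_E_gen u, 0)
  | u :: s', i'.+1 => (0, pm_free_gen s' i')
  end.

Lemma pm_free_comb_cons u s z (c : nat -> 'F_2) :
  \sum_(0 <= i < size (u :: s)) c i *: pm_push z (pm_free_gen (u :: s) i)
  = (c 0 *: pm_push z (pm_E_gen u),
     \sum_(0 <= i < size s) c i.+1 *: pm_push z (pm_free_gen s i)).
Proof.
rewrite big_nat_recl //= pm_push_dsum /= push0.
have -> : \sum_(0 <= i < size s) c i.+1 *: pm_push z (pm_free_gen (u :: s) i.+1)
    = (0, \sum_(0 <= i < size s) c i.+1 *: pm_push z (pm_free_gen s i))
    :> pm_dsum (pm_E u) (pm_free s) z.
  elim/big_ind2: _ => [|x1 [x2 x3] y1 [y2 y3] [-> ->] [-> ->]|i _] //.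
    by apply: (congr2 pair); first exact: addr0.
  by rewrite pm_push_dsum /= push0; apply: (congr2 pair); first exact: scaler0.
apply: (congr2 pair); first exact: addr0.
exact: etrans (congr1 (+%R^~ _) (scaler0 _ _)) (add0r _).
Qed.

Lemma pm_free_spanned s z (x : pm_free s z) :
  exists c, \sum_(0 <= i < size s) c i *: pm_push z (pm_free_gen s i) = x.
Proof.
elim: s x => [|u s IH] x.
  by exists (fun=> 0); rewrite big_nil; apply/rowP; case.
case: x => a y; have [a0 aE] := pm_E_spanned a; have [c cE] := IH y.
exists (fun i => if i is i'.+1 then c i' else a0).
by rewrite pm_free_comb_cons aE cE.
Qed.

Lemma pm_free_free s z c :
  \sum_(0 <= i < size s) c i *: pm_push z (pm_free_gen s i) = 0 ->
  forall i, (i < size s)%N -> (nth grade0 s i <= z)%O -> c i = 0.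
Proof.
elim: s c => [|u s IH] c //.
rewrite pm_free_comb_cons => -[a0 /(IH (fun i => c i.+1)) cs0] [_ uz|i] //=.
  exact: pm_E_free uz a0.
exact: cs0.
Qed.

Section FreeOn.
Variables (r : nat) (gr : 'I_r -> grade).

Definition free_on : pmod := pm_free [seq gr i | i <- enum 'I_r].

(* [nth grade0 _ i] and [gr i] are equal but not convertible; pushing forward
   replaces a cast. *)
Definition free_on_gen (i : 'I_r) : free_on (gr i) :=
  pm_push (gr i) (pm_free_gen _ i).

Lemma free_on_grade (i : 'I_r) : nth grade0 [seq gr i | i <- enum 'I_r] i = gr i.
Proof. by rewrite (nth_map i) ?size_enum_ord // nth_ord_enum. Qed.

Lemma free_on_size : size [seq gr i | i <- enum 'I_r] = r.
Proof. by rewrite size_map size_enum_ord. Qed.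

Lemma comb_free_on z (c : nat -> 'F_2) (c' : 'cV_r) :
  (forall i : 'I_r, c i = c' i 0) ->
  comb free_on_gen z c'
  = \sum_(0 <= i < size [seq gr i | i <- enum 'I_r])
      c i *: pm_push z (pm_free_gen _ i).
Proof.
move=> cE; rewrite free_on_size big_mkord; apply: eq_bigr => i _.
rewrite cE; congr (_ *: _); have [iz|iz] := boolP (gr i <= z)%O.
  by rewrite pm_push_push ?free_on_grade.
by rewrite !pm_push0 ?free_on_grade.
Qed.

Lemma free_on_free_basis : free_basis free_on_gen.
Proof.
split=> [z x|z c /gradedP gc].
  have [c cE] := pm_free_spanned x; exists (\col_i (if (gr i <= z)%O then c i else 0)).
    by apply/gradedP => i j; rewrite mxE; case: ifP.
  rewrite -[RHS]cE -(@comb_free_on _ _ (\col_i c i)) => [|i]; last by rewrite mxE.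
  by rewrite !comb_le; apply: eq_bigr => i iz; rewrite !mxE iz.
pose d k := if insub k is Some i then c i 0 else 0.
have dE (i : 'I_r) : d i = c i 0 by rewrite /d valK.
rewrite (comb_free_on _ dE) => /pm_free_free d0.
apply/colP => i; rewrite mxE; apply/eqP/idPn => ci.
by case/eqP: (ci); rewrite -dE (d0 i) ?free_on_size ?free_on_grade ?(gc _ _ ci).
Qed.

End FreeOn.

Lemma pmod_iso_refl M : pmod_iso M M.
Proof. by exists (hom_id M), (hom_id M). Qed.

Lemma fg_free_free_basis M : fg_free M ->
  exists (p : nat) (gr : 'I_p -> grade) (e : forall i, M (gr i)), free_basis e.
Proof.
move=> [s].
pose gr (i : 'I_(size s)) := nth grade0 s i.
(* Reading [s] as the list of values of [gr] turns the given isomorphism into one with [free_on gr],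
   whose basis is then carried over to [M]. *)
have sE : [seq gr i | i <- enum 'I_(size s)] = s.
  apply: (@eq_from_nth _ grade0); rewrite size_map size_enum_ord // => i lti.
  by rewrite (nth_map (Ordinal lti)) ?size_enum_ord // /gr (nth_enum_ord _ lti).
rewrite -{1}sE => -[f [g [gf fg]]].
exists _, gr, (fun i => g (gr i) (free_on_gen gr i)).
have [gb ib] := free_on_free_basis gr.
have combE z c : comb (fun i => g (gr i) (free_on_gen gr i)) z c
    = g z (comb (free_on_gen gr) z c).
  rewrite [in RHS]/comb linear_sum; apply: eq_bigr => i _.
  by rewrite linearZ /= -(hom_push g).
split=> [z x|z c gc].
  have [c gc cE] := gb z (f z x); exists c => //.
  by rewrite combE cE gf.
rewrite combE => gc0; apply: (ib z) => //.
by rewrite -[LHS]fg gc0 linear0.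
Qed.

(** * Chain complexes and graded matrices *)

Definition graded_bd (D : graded_matrices) : Prop :=
  forall n, graded (@gm_gr D n) (@gm_gr D n.+1) (gm_bd D n).

Lemma coords_inj (M : pmod) r (gr : 'I_r -> grade) (b : forall i, M (gr i))
  (fb : free_basis b) z (x y : M z) : coords fb x = coords fb y -> x = y.
Proof. exact: can_inj (coordsK fb (z := z)) x y. Qed.

Section Represented.
Variables (F : chain_complex) (D : graded_matrices) (B : ordered_bases F D).
Arguments B : clear implicits.
Hypothesis rB : represented_by B.

Lemma represented_graded : graded_bd D.
Proof. by case: rB => _ _ gD _ n; apply/gradedP => i j; apply: gD. Qed.

Lemma represented_free_basis n : free_basis (B n).
Proof.
case: rB => ffF bB _ _.
have [p [gr [e fe]]] := fg_free_free_basis (ffF n).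
exact: is_basis_free fe (bB n).
Qed.

Let fB := represented_free_basis.

Lemma coords_bd n z (x : F n.+1 z) :
  coords (fB n) (bd F n z x) = gm_bd D n *m coords (fB n.+1) x.
Proof.
have gx := graded_coords (fB n.+1) x.
apply: (comb_inj (fB n)) (graded_coords _ _) (gradedM (represented_graded n) gx) _.
rewrite coordsK (@comb_trans _ _ _ _ _
    (fun j => bd F n (gm_gr j) (B n.+1 j)) (B n)) //.
- rewrite -[in LHS](coordsK (fB n.+1) x) /comb linear_sum.
  by apply: eq_bigr => j _; rewrite linearZ /= hom_push.
- exact: represented_graded.
move=> j; case: rB => _ _ _ ->; rewrite comb_le.
by apply: eq_bigr => i _; rewrite mxE.
Qed.

Lemma represented_bd_bd n : gm_bd D n *m gm_bd D n.+1 = 0.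
Proof.
apply/matrixP => i j.
have /(congr1 (@coords _ _ _ _ (fB n) _)) := bd_bd (B n.+2 j).
rewrite !coords_bd coords_basis linear0 mulmxA -colE => /colP/(_ i).
by rewrite !mxE.
Qed.

End Represented.

(** Graded matrices define homomorphisms between the standard free modules, and vanishing products
    of matrices make them boundaries. *)
Lemma represented_exists (D : graded_matrices) :
  graded_bd D -> (forall n, gm_bd D n *m gm_bd D n.+1 = 0) ->
  exists (F : chain_complex) (B : ordered_bases F D), represented_by B.
Proof.
move=> gD dd.
pose M n := free_on (@gm_gr D n).
pose B n : forall i, M n (gm_gr i) := free_on_gen (@gm_gr D n).
have fB n : free_basis (B n) by apply: free_on_free_basis.
pose d n : pmod_hom (M n.+1) (M n) := hom_mx (fB n.+1) (B n) (gD n).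
have ddM n z (x : M n.+2 z) : d n z (d n.+1 z x) = 0.
  apply: (coords_inj (fb := fB n)).
  by rewrite !coords_hom_mx mulmxA dd mul0mx linear0.
exists (ChainComplex ddM), B; split=> [n|n|n|n j].
- by exists [seq gm_gr i | i <- enum 'I_(gm_rank D n)]; apply: pmod_iso_refl.
- exact: free_basis_is_basis.
- exact/gradedP/gD.
rewrite /= /hom_mx_fun coords_basis -colE comb_le.
by apply: eq_bigr => i _; rewrite mxE.
Qed.

Section MatrixHomotopy.
Variables (F G : chain_complex) (D E : graded_matrices).
Variables (B : ordered_bases F D) (C : ordered_bases G E).
Arguments B : clear implicits.
Arguments C : clear implicits.
Hypotheses (rB : represented_by B) (rC : represented_by C).
Variables (phi : forall n, 'M['F_2]_(gm_rank E n, gm_rank D n))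
          (psi : forall n, 'M['F_2]_(gm_rank D n, gm_rank E n))
          (k : forall n, 'M['F_2]_(gm_rank D n.+1, gm_rank D n)).
Hypotheses (gphi : forall n, graded (@gm_gr E n) (@gm_gr D n) (phi n))
           (gpsi : forall n, graded (@gm_gr D n) (@gm_gr E n) (psi n))
           (gk : forall n, graded (@gm_gr D n.+1) (@gm_gr D n) (k n)).
Hypotheses
  (phi_bd : forall n, phi n *m gm_bd D n = gm_bd E n *m phi n.+1)
  (psi_bd : forall n, psi n *m gm_bd E n = gm_bd D n *m psi n.+1)
  (phi_psi : forall n, phi n *m psi n = 1%:M)
  (psi_phi0 : psi 0 *m phi 0 = 1%:M + gm_bd D 0 *m k 0)
  (psi_phiS : forall n, psi n.+1 *m phi n.+1
     = 1%:M + gm_bd D n.+1 *m k n.+1 + k n *m gm_bd D n).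

(** Coordinates are injective, so every identity of maps can be checked on matrices. As
    [phi psi = 1], the zero homotopy suffices on the side of [G]. *)
Lemma homotopy_equivalent_mx : homotopy_equivalent F G.
Proof.
pose fB := represented_free_basis rB; pose fC := represented_free_basis rC.
pose f n := hom_mx (fB n) (C n) (gphi n).
pose g n := hom_mx (fC n) (B n) (gpsi n).
pose h n := hom_mx (fB n) (B n.+1) (gk n).
have fP n z (x : F n z) : coords (fC n) (f n z x) = phi n *m coords (fB n) x.
  exact: coords_hom_mx.
have gP n z (x : G n z) : coords (fB n) (g n z x) = psi n *m coords (fC n) x.
  exact: coords_hom_mx.
have hP n z (x : F n z) : coords (fB n.+1) (h n z x) = k n *m coords (fB n) x.
  exact: coords_hom_mx.
have dF n z (x : F n.+1 z) :
    coords (fB n) (bd F n z x) = gm_bd D n *m coords (fB n.+1) x.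
  exact: coords_bd.
have dG n z (x : G n.+1 z) :
    coords (fC n) (bd G n z x) = gm_bd E n *m coords (fC n.+1) x.
  exact: coords_bd.
have f_bd n z (x : F n.+1 z) : f n z (bd F n z x) = bd G n z (f n.+1 z x).
  by apply: (coords_inj (fb := fC n)); rewrite fP dF dG fP !mulmxA phi_bd.
have g_bd n z (x : G n.+1 z) : g n z (bd G n z x) = bd F n z (g n.+1 z x).
  by apply: (coords_inj (fb := fB n)); rewrite gP dF dG gP !mulmxA psi_bd.
exists (ChainMap f_bd), (ChainMap g_bd); split.
  have fg n z (x : G n z) : f n z (g n z x) - x = 0.
    apply: (coords_inj (fb := fC n)).
    by rewrite linearB linear0 /= fP gP mulmxA phi_psi mul1mx subrr.
  have g0 n : graded (@gm_gr E n.+1) (@gm_gr E n) 0.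
    by apply/gradedP => i j; rewrite mxE.
  pose o n := hom_mx (fC n) (C n.+1) (g0 n).
  have oP n z (x : G n z) : o n z x = 0.
    by apply: (coords_inj (fb := fC n.+1)); rewrite coords_hom_mx mul0mx linear0.
  exists o; split=> [z x|n z x]; first by rewrite oP linear0 [RHS]fg.
  by rewrite !oP linear0 addr0 [RHS]fg.
exists h; split=> [z x|n z x].
  apply: (coords_inj (fb := fB 0)); rewrite linearB /= dF hP gP fP !mulmxA psi_phi0.
  by rewrite mulmxDl mul1mx addrC addKr.
apply: (coords_inj (fb := fB n.+1)); rewrite linearD linearB /= !(dF, hP, gP, fP).
rewrite !mulmxA psi_phiS !mulmxDl mul1mx.
by rewrite [RHS]addrC -addrA addKr.
Qed.

End MatrixHomotopy.

(** * Graded inverses of triangular blocks *)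

Section Projections.
Variable n : nat.
Implicit Types S : {set 'I_n}.

Definition proj S : 'M['F_2]_n := \matrix_(i, j) ((i == j) && (i \in S))%:R.

Lemma proj_mul p S (X : 'M_(n, p)) i j :
  (proj S *m X) i j = if i \in S then X i j else 0.
Proof.
rewrite mxE (bigD1 i) //= mxE eqxx big1 ?addr0 => [|k ki].
  by case: (i \in S); rewrite ?mul1r ?mul0r.
by rewrite mxE eq_sym (negPf ki) mul0r.
Qed.

Lemma mul_proj p S (X : 'M_(p, n)) i j :
  (X *m proj S) i j = if j \in S then X i j else 0.
Proof.
rewrite mxE (bigD1 j) //= mxE eqxx big1 ?addr0 => [|k kj].
  by case: (j \in S); rewrite ?mulr1 ?mulr0.
by rewrite mxE (negPf kj) mulr0.
Qed.

Lemma proj_idem S : proj S *m proj S = proj S.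
Proof.
apply/matrixP => i j; rewrite proj_mul !mxE.
by case: (i \in S); rewrite ?andbF.
Qed.

Lemma trmx_proj S : (proj S)^T = proj S.
Proof. by apply/matrixP => i j; rewrite !mxE eq_sym; have [->|] := eqVneq i j. Qed.

Lemma projC S : proj (~: S) = 1%:M - proj S.
Proof.
apply/matrixP => i j; rewrite !mxE inE.
by case: (i == j); case: (i \in S); rewrite ?subrr ?subr0.
Qed.

Lemma graded_proj (gr : 'I_n -> grade) S : graded gr gr (proj S).
Proof. by apply/gradedP => i j; rewrite mxE; have [->|] := eqVneq i j. Qed.

(** Back substitution from the last row: by [W (invmx W) = 1], a nonzero entry (i, j) of the inverse
    has i = j or comes from some l > i with [W i l] and the inverse entry (l, j) nonzero, whence
    [gr i <= gr l <= gr j]. *)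
Lemma unitriangular_inv (gr : 'I_n -> grade) (W : 'M['F_2]_n) :
  graded gr gr W -> (forall i j : 'I_n, (j < i)%N -> W i j = 0) ->
  (forall i, W i i = 1) -> W \in unitmx /\ graded gr gr (invmx W).
Proof.
move=> /gradedP gW Wtri W1.
have uW : W \in unitmx.
  rewrite unitmxE -det_tr det_trig ?big1 ?unitr1 // => [i _|].
    by rewrite mxE W1.
  by apply/is_trig_mxP => i j ij; rewrite mxE Wtri.
split=> //; apply/gradedP => i j.
have [k] := ubnP (n - i)%N; elim: k => // k IH in i * => lek nz.
apply/idPn => ij; have /matrixP/(_ i j) := mulmxV uW.
rewrite !mxE (bigD1 i) //= W1 mul1r big1 => [|l li].
  case: eqVneq => [E|_] /eqP; first by rewrite E lexx in ij.
  by rewrite addr0 (negPf nz).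
apply/eqP; rewrite mulf_eq0; apply/idPn; rewrite negb_or => /andP[Wil Vlj].
have il : (i < l)%N.
  by rewrite ltn_neqAle eq_sym li leqNgt; apply: contraNN Wil => /Wtri->.
case/negP: ij; apply: le_trans (gW _ _ Wil) _; apply: IH => //.
by rewrite ltnS in lek; apply: leq_trans lek; apply: ltn_sub2l.
Qed.

End Projections.

Section Contraction.
Variables (m n : nat) (rgr : 'I_m -> grade) (cgr : 'I_n -> grade).
Variables (pos : {set 'I_m}) (neg : {set 'I_n}).

(* [h] is the inverse of the block of [A] with rows [pos] and columns [neg],
   extended by zero. *)
Definition contraction (A : 'M['F_2]_(m, n)) (h : 'M['F_2]_(n, m)) : bool :=
  [&& graded cgr rgr h, proj neg *m h == h, h *m proj pos == h,
      proj pos *m A *m h == proj pos & h *m A *m proj neg == proj neg].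

(** The last condition on [U] says that it only adds columns in [neg]. So [U] and its inverse
    preserve the vectors supported on [neg], and an inverse of the block of [A U] becomes one for
    [A] after multiplication by [U]. *)
Lemma contraction_mulr (A : 'M_(m, n)) (U : 'M_n) h :
  U \in unitmx -> graded cgr cgr U -> proj (~: neg) *m U = proj (~: neg) ->
  contraction (A *m U) h -> contraction A (U *m h).
Proof.
move=> uU gU KU /and5P[gh /eqP nh /eqP hp /eqP ph /eqP hn].
have KV : proj (~: neg) *m invmx U = proj (~: neg).
  by rewrite -{1}KU -mulmxA mulmxV // mulmx1.
have absorb p (V : 'M_n) (X : 'M_(n, p)) :
    proj (~: neg) *m V = proj (~: neg) -> proj neg *m X = X ->
    proj neg *m (V *m X) = V *m X.
  move=> KV' nX; apply/eqP; rewrite -subr_eq0 -opprB -{1}[V *m X]mul1mx -mulmxBl.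
  by rewrite -projC mulmxA KV' projC mulmxBl mul1mx nX subrr oppr0.
apply/and5P; split.
- exact: gradedM gU gh.
- by rewrite absorb.
- by rewrite -mulmxA hp.
- by rewrite mulmxA -(mulmxA _ A) ph.
(* [invmx U *m proj neg] has its rows in [neg], so [h A U] fixes it; multiplying by [U] gives
   [U h A proj neg = proj neg]. *)
have nV := absorb _ _ _ KV (proj_idem neg).
rewrite -{1}[proj neg]mul1mx -(mulmxV uU) -(mulmxA U (invmx U)) -nV.
rewrite !mulmxA -(mulmxA U h A) -(mulmxA U) -(mulmxA U) -(mulmxA h A) hn.
by rewrite -!mulmxA nV mulmxA mulmxV // mul1mx.
Qed.

Lemma local_pivotP (A : 'M['F_2]_(m, n)) c i :
  reflect [/\ A i c != 0, forall i', A i' c != 0 -> (i' <= i)%N & rgr i = cgr c]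
          (local_pivot rgr cgr A c == Some i).
Proof.
rewrite /local_pivot /pivot; case: pickP => [k /andP[Akc /forallP mx]|no].
  have {}mx i' : A i' c != 0 -> (i' <= k)%N by apply/implyP.
  case: (rgr k =P cgr c) => [gk|gk].
    apply: (iffP eqP) => [[<-]|[Aic mxi _]] //.
    by congr Some; apply/val_inj/anti_leq; rewrite mxi ?mx.
  apply: (iffP eqP) => // -[Aic mxi gi]; case: gk.
  suff -> : k = i by [].
  by apply/val_inj/anti_leq; rewrite mxi ?mx.
apply: (iffP eqP) => // -[Aic mxi _]; have := no i; rewrite Aic /=.
by move/negP; case; apply/forallP => i'; apply/implyP/mxi.
Qed.

(** Ordering the columns of the block by their pivots makes it unitriangular. The inverse is graded
    because a local pivot has the grade of its column. *)
Lemma triangular_contraction (A : 'M['F_2]_(m, n)) :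
  graded rgr cgr A ->
  (forall c, c \in neg -> exists2 i, i \in pos & local_pivot rgr cgr A c = Some i) ->
  (forall i, i \in pos -> exists2 c, c \in neg & local_pivot rgr cgr A c = Some i) ->
  {in neg &, injective (local_pivot rgr cgr A)} ->
  exists h, contraction A h.
Proof.
move=> gA neg_pos pos_neg lp_inj.
(* [S] is the partial permutation matching each column of [neg] with its pivot row; its transpose
   inverts it between [neg] and [pos]. *)
pose S := \matrix_(c, i) ((c \in neg) && (local_pivot rgr cgr A c == Some i))%:R
  : 'M['F_2]_(n, m).
have SP c i : S c i != 0 -> c \in neg /\ local_pivot rgr cgr A c = Some i.
  by rewrite mxE; case: andP => // -[-> /eqP ->].
have gS : graded cgr rgr S.
  by apply/gradedP => c i /SP[_ /eqP/local_pivotP[_ _ ->]].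
have S_pos : S *m proj pos = S.
  apply/matrixP => c i; rewrite mul_proj; case: ifP => // /negP ip.
  apply/esym/eqP/idPn => /SP[cn lpc]; case: ip.
  by have [i' i'p] := neg_pos _ cn; rewrite lpc => -[->].
have neg_S : proj neg *m S = S.
  apply/matrixP => c i; rewrite proj_mul; case: ifP => // cn.
  by rewrite mxE cn.
have SST : S *m S^T = proj neg.
  apply/matrixP => c c'; rewrite !mxE.
  have [cn|cn] := boolP (c \in neg); last first.
    by rewrite andbF big1 // => i _; rewrite mxE (negPf cn) mul0r.
  have [i ip lpc] := neg_pos _ cn.
  rewrite (bigD1 i) //= big1 ?addr0 => [|j ji]; last first.
    by rewrite mxE lpc (inj_eq Some_inj) eq_sym (negPf ji) andbF mul0r.
  rewrite !mxE cn lpc eqxx /= mul1r andbT; have [<-|cc'] := eqVneq c c'.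
    by rewrite cn lpc eqxx.
  case: andP => // -[c'n /eqP lpc'].
  by case/eqP: cc'; apply: lp_inj => //; rewrite lpc.
pose T := proj pos *m A.
(* For [i] in [pos], column [i] of [W] is the column of [A] with pivot [i], cut to the rows in
   [pos]: it is 1 at [i] and 0 after. The other columns are those of the identity. *)
pose W := T *m S + proj (~: pos).
have gT : graded rgr cgr T by apply: gradedM (graded_proj _ _) gA.
have gW : graded rgr rgr W.
  by apply: gradedD (gradedM gT gS) (graded_proj _ _).
have [|i|uW gV] := unitriangular_inv gW.
- move=> i j ji; rewrite mxE -mulmxA proj_mul [X in _ + X]mxE.
  rewrite -val_eqE gtn_eqF //= addr0; case: ifP => // ip.
  rewrite mxE big1 // => c _; apply/eqP; rewrite mulf_eq0; apply/idPn.
  rewrite negb_or => /andP[Aic /SP[cn /eqP/local_pivotP[_ /(_ _ Aic)]]].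
  by rewrite leqNgt ji.
- rewrite mxE -mulmxA proj_mul [X in _ + X]mxE eqxx inE.
  case: ifP => [ip|]; last by rewrite add0r.
  have [c cn lpc] := pos_neg _ ip.
  rewrite addr0 mxE (bigD1 c) //= mxE cn lpc eqxx mulr1 big1 => [|c' c'c].
    by rewrite addr0; apply: F2_neq0; move/eqP/local_pivotP: lpc => [].
  rewrite mxE; case: andP => [[c'n /eqP lpc']|]; last by rewrite mulr0.
  by case/eqP: c'c; apply: lp_inj => //; rewrite lpc'.
have KV : proj (~: pos) *m invmx W = proj (~: pos).
  have KW : proj (~: pos) *m W = proj (~: pos).
    rewrite mulmxDr proj_idem /T !mulmxA projC mulmxBl mul1mx proj_idem subrr.
    by rewrite !mul0mx add0r.
by rewrite -{1}KW -mulmxA mulmxV // mulmx1.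
have Kp : proj (~: pos) *m proj pos = 0.
  by rewrite projC mulmxBl mul1mx proj_idem subrr.
exists (S *m invmx W *m proj pos); apply/and5P; split.
- by apply: gradedM (graded_proj _ _); apply: gradedM gS gV.
- by rewrite !mulmxA neg_S.
- by rewrite -!mulmxA proj_idem.
- have -> : proj pos *m A *m (S *m invmx W *m proj pos)
    = (W - proj (~: pos)) *m invmx W *m proj pos by rewrite addrK !mulmxA.
  by rewrite mulmxBl mulmxV // KV mulmxBl mul1mx Kp subr0.
have -> : S *m invmx W *m proj pos *m A *m proj neg
    = S *m invmx W *m (T *m S) *m S^T by rewrite -SST /T !mulmxA.
have -> : T *m S = W - proj (~: pos) by rewrite addrK.
have KST : proj (~: pos) *m S^T = 0.
  rewrite -[proj _]trmx_proj -trmx_mul projC mulmxBr mulmx1 S_pos subrr.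
  exact: trmx0.
by rewrite -mulmxA mulmxBl KST subr0 mulmxA mulmxKV ?SST.
Qed.

End Contraction.

(** * Local reduction *)

(** Shows that a bounded iteration carries out the whole while loop: with enough fuel it ends at a
    fixed point. *)
Lemma iter_decreasing T (f : T -> T) (mu : T -> nat) n x :
  (forall y, f y = y \/ (mu (f y) < mu y)%N) -> (mu x <= n)%N ->
  f (iter n f x) = iter n f x.
Proof.
move=> f_dec; elim: n x => [|n IH] x lex.
  by case: (f_dec x) => //=; rewrite ltnNge (leq_trans lex).
case: (f_dec x) => [fx|lt]; first by rewrite iter_fix.
by rewrite iterSr IH // -ltnS (leq_trans lt).
Qed.

Lemma iter_invariant T (f : T -> T) (P : T -> Prop) n x :
  P x -> (forall y, P y -> P (f y)) -> P (iter n f x).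
Proof. by move=> Px Pf; elim: n => //= n; apply: Pf. Qed.

Section Columns.
Variables (m n : nat) (rgr : 'I_m -> grade) (cgr : 'I_n -> grade).
Implicit Types (A B C : 'M['F_2]_(m, n)) (c : 'I_n) (Q : pred 'I_m).

Let lpiv := local_pivot rgr cgr.

Lemma eq_local_pivot A A' c :
  (forall i, A i c = A' i c) -> lpiv A c = lpiv A' c.
Proof.
move=> E; rewrite /lpiv /local_pivot /pivot; congr (if _ is Some i then _ else _).
apply: eq_pick => i /=; rewrite E; congr (_ && _).
by apply: eq_forallb => i'; rewrite E.
Qed.

Lemma add_colE c c' A : add_col c c' A = A *m (1%:M + delta_mx c' c).
Proof.
apply/matrixP => i j; rewrite mulmxDr mulmx1 !mxE (bigD1 c') //= big1 => [|k kc'].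
  rewrite mxE eqxx addr0 /=; case: eqVneq => [->|_]; first by rewrite mulr1.
  by rewrite mulr0 addr0.
by rewrite mxE (negPf kc') mulr0.
Qed.

(** Termination measure of both loops, with [Q] all rows in the reduction and the local rows in the
    compression. The shift by one distinguishes an entry in row 0 from no entry. *)
Definition col_height Q A c : nat := \max_(i | Q i && (A i c != 0)) i.+1.

Lemma col_height_le Q A c : (col_height Q A c <= m)%N.
Proof. by apply/bigmax_leqP => i _. Qed.

Lemma col_height_lt Q A B c i :
  Q i -> A i c != 0 -> (forall i', Q i' -> B i' c != 0 -> (i' < i)%N) ->
  (col_height Q B c < col_height Q A c)%N.
Proof.
move=> Qi Aic lt; apply: (@leq_trans i.+1).
  by rewrite ltnS; apply/bigmax_leqP => i' /andP[/lt]; apply.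
by apply: (@leq_bigmax_cond _ _ (fun i : 'I_m => i.+1)); rewrite Qi.
Qed.

(** The two ones in row [i] cancel over F_2, and [c'] has no entry after its pivot [i]. *)
Lemma col_height_add_col Q A c c' i :
  Q i -> A i c != 0 -> (forall i', Q i' -> A i' c != 0 -> (i' <= i)%N) ->
  lpiv A c' = Some i ->
  (col_height Q (add_col c c' A) c < col_height Q A c)%N.
Proof.
move=> Qi Aic mx /eqP/local_pivotP[Aic' mx' _].
apply: (col_height_lt Qi Aic) => i' Qi'; rewrite mxE eqxx => nz.
rewrite ltn_neqAle; apply/andP; split.
  apply: contraNneq nz => /val_inj->.
  by rewrite (F2_neq0 Aic) (F2_neq0 Aic') F2_addxx.
have [E|] := eqVneq (A i' c) 0; last exact: mx.
by apply: mx'; apply: contraNneq nz => ->; rewrite E addr0.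
Qed.

(** Outside [neg] the rows of [U] are those of the identity, so only columns in [neg] are added to
    others. *)
Definition col_ops (neg : {set 'I_n}) A A' : Prop :=
  exists U : 'M_n, [/\ U \in unitmx, graded cgr cgr U,
    proj (~: neg) *m U = proj (~: neg) & A' = A *m U].

Lemma col_ops_refl neg A : col_ops neg A A.
Proof. by exists 1%:M; rewrite unitmx1 graded1 !mulmx1. Qed.

Lemma col_ops_trans neg A B C : col_ops neg A B -> col_ops neg B C -> col_ops neg A C.
Proof.
move=> [U [uU gU KU ->]] [V [uV gV KV ->]]; exists (U *m V).
by rewrite unitmx_mul uU uV (gradedM gU gV) !mulmxA KU KV.
Qed.

Lemma col_ops_sub (neg neg' : {set 'I_n}) A B :
  neg \subset neg' -> col_ops neg A B -> col_ops neg' A B.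
Proof.
move=> /subsetP sub [U [uU gU KU ->]]; exists U; split=> //.
have KK : proj (~: neg') *m proj (~: neg) = proj (~: neg').
  apply/matrixP => i j; rewrite proj_mul !mxE !inE.
  have [/sub->|_] := boolP (i \in neg); first by rewrite andbF.
  by case: (i \in neg'); rewrite ?andbF.
by rewrite -KK -mulmxA KU.
Qed.

Lemma col_ops_add_col (neg : {set 'I_n}) c c' A :
  c' \in neg -> c != c' -> (cgr c' <= cgr c)%O -> col_ops neg A (add_col c c' A).
Proof.
move=> c'n cc' c'c; exists (1%:M + delta_mx c' c); split.
- suff /mulmx1_unit[] :
    (1%:M + delta_mx c' c) *m (1%:M + delta_mx c' c) = 1%:M :> 'M['F_2]_n by [].
  rewrite mulmxDl mul1mx mulmxDr mulmx1 mul_delta_mx_0 // addr0 -addrA.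
  have -> : delta_mx c' c + delta_mx c' c = 0 :> 'M['F_2]_n.
    by apply/matrixP => i j; rewrite !mxE F2_addxx.
  exact: addr0.
- apply: gradedD (graded1 _) _; apply/gradedP => i j; rewrite mxE.
  by have [->|//] := eqVneq i c'; have [->|] := eqVneq j c.
- rewrite mulmxDr mulmx1 (_ : _ *m delta_mx _ _ = 0) ?addr0 //.
  apply/matrixP => i j; rewrite proj_mul !mxE inE.
  by case: ifP => // iN; case: eqVneq => // ic; rewrite ic c'n in iN.
exact: add_colE.
Qed.

(** Each addition lowers the pivot, so [m] rounds end at a fixed point; there a negative column with
    the same local pivot would still trigger an addition, a contradiction. *)
Lemma reduce_iter (neg : {set 'I_n}) c A :
  (forall c', c' \in neg -> (c' < c)%N) ->
  let A1 := iter m (reduce_step rgr cgr neg c) A in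
  [/\ col_ops neg A A1, forall i j, j != c -> A1 i j = A i j
    & forall c' i, c' \in neg -> lpiv A1 c = Some i -> lpiv A1 c' != Some i].
Proof.
move=> negc A1.
have step B : reduce_step rgr cgr neg c B = B \/
    exists2 c', c' \in neg & exists2 i, lpiv B c = Some i &
      lpiv B c' = Some i /\ reduce_step rgr cgr neg c B = add_col c c' B.
  rewrite /reduce_step; case: pickP => [c' /and4P[c'n _]|_]; last by left.
  rewrite -/lpiv; case E: (lpiv B c) => [i|] // _ /eqP lc'.
  by right; exists c' => //; exists i.
split.
- apply: (@iter_invariant _ _ (col_ops neg A)); first exact: col_ops_refl.
  move=> B IH; case: (step B) => [->//|].
  move=> [c' c'n [i /eqP/local_pivotP[_ _ gi] [/eqP/local_pivotP[_ _ gi'] ->]]].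
  apply: col_ops_trans IH _; apply: col_ops_add_col => //.
    by rewrite -val_eqE gtn_eqF ?negc.
  by rewrite -gi -gi'.
- apply: (@iter_invariant _ _ (fun B => forall i j, j != c -> B i j = A i j)) => //.
  move=> B IH i j jc; case: (step B) => [->|]; first exact: IH.
  by move=> [c' _ [i' _ [_ ->]]]; rewrite mxE (negPf jc) IH.
move=> c' i c'n lc; apply/negP => /eqP lc'.
have dec B : reduce_step rgr cgr neg c B = B \/
    (col_height predT (reduce_step rgr cgr neg c B) c < col_height predT B c)%N.
  case: (step B) => [|[d _ [j /eqP/local_pivotP[Bj mx _] [ld ->]]]]; [by left|right].
  by apply: (@col_height_add_col _ _ _ _ j) => // i' _; apply: mx.
have fixA1 : reduce_step rgr cgr neg c A1 = A1.
  by apply: (iter_decreasing dec); apply: col_height_le.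
move: fixA1; rewrite /reduce_step; case: pickP => [d /and4P[dn _ _ /eqP ld] E|].
  have /local_pivotP[A1i mx _] : lpiv A1 c == Some i by apply/eqP.
  have := @col_height_add_col predT A1 c d i isT A1i (fun i' _ => mx i').
  by rewrite E ltnn /lpiv ld; move/(_ lc).
by move/(_ c'); rewrite c'n negc // -/lpiv lc lc' eqxx.
Qed.

Section LocalReduction.
Variables (pos : {set 'I_n}) (A : 'M['F_2]_(m, n)).

Let st := local_reduction rgr cgr pos A.

(** Invariant of the traversal; the last three clauses make the local pivot a bijection from
    negative columns to positive rows. *)
Definition reduced (r : reduction_state m n) : Prop :=
  [/\ col_ops (rs_neg r) A (rs_mx r),
      {in rs_neg r, forall c, c \notin pos},
      forall c, c \in rs_neg r ->
        exists2 i, i \in rs_pos r & lpiv (rs_mx r) c = Some i,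
      forall i, i \in rs_pos r ->
        exists2 c, c \in rs_neg r & lpiv (rs_mx r) c = Some i
    & {in rs_neg r &, injective (lpiv (rs_mx r))}].

Lemma local_reduction_reduced : reduced st.
Proof.
(* Negative columns lie in the visited prefix of an increasing list, hence all precede the column
   visited next. *)
suff H s : pairwise (fun c c' : 'I_n => (c < c')%N) s ->
    reduced (foldl (visit rgr cgr pos) (ReductionState A set0 set0) s) /\
    {subset rs_neg (foldl (visit rgr cgr pos) (ReductionState A set0 set0) s) <= s}.
  apply: proj1 (H (enum 'I_n) _).
  rewrite -(pairwise_map val ltn) val_enum_ord.
  by rewrite -sorted_pairwise ?iota_ltn_sorted //; apply: ltn_trans.
elim/last_ind: s => [_|s c IH].
  split=> [|c]; last by rewrite inE.
  split=> [|||| c c'] /=; first exact: col_ops_refl.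
  - by move=> c; rewrite inE.
  - by move=> c; rewrite inE.
  - by move=> c; rewrite inE.
  by rewrite inE.
rewrite pairwise_rcons => /andP[/allP lt /IH[]] {IH}.
rewrite foldl_rcons; case: (foldl _ _ _) => B neg ps [/= ops dis neg_pos pos_neg inj] sub.
have negc c' : c' \in neg -> (c' < c)%N by move/sub/lt.
rewrite /visit /=; case: ifP => [cp|cp].
  by split=> // c' /sub c's; rewrite mem_rcons inE c's orbT.
have [ops1 keep new] := reduce_iter B negc.
set A1 := iter _ _ _ in ops1 keep new *; rewrite -/lpiv.
have keep_lp c' : c' \in neg -> lpiv A1 c' = lpiv B c'.
  move=> c'n; apply: eq_local_pivot => i; apply: keep.
  by rewrite -val_eqE ltn_eqF ?negc.
have opsA : col_ops neg A A1 by apply: col_ops_trans ops ops1.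
case lc: (lpiv A1 c) => [i|]; last first.
  split=> [|c' /sub c's]; last by rewrite mem_rcons inE c's orbT.
  split=> //= [c' c'n|i ip|c1 c2 n1 n2].
  - by rewrite keep_lp //; apply: neg_pos.
  - by have [c' c'n lc'] := pos_neg _ ip; exists c'; rewrite ?keep_lp.
  by rewrite !keep_lp //; apply: inj.
split=> [|c'] /=; last first.
  by rewrite mem_rcons !inE => /orP[->//|/sub->]; rewrite orbT.
split=> /=.
- by apply: col_ops_sub opsA; apply: subsetUr.
- by move=> c' /setU1P[->|/dis//]; rewrite cp.
- move=> c' /setU1P[->|c'n]; first by exists i; rewrite ?setU11.
  have [i' i'p lc'] := neg_pos _ c'n; exists i'; last by rewrite keep_lp.
  by rewrite inE i'p orbT.
- move=> i' /setU1P[->|/pos_neg[c' c'n lc']]; first by exists c; rewrite ?setU11.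
  by exists c'; rewrite ?keep_lp // inE c'n orbT.
move=> c1 c2 /setU1P[->|n1] /setU1P[->|n2] //.
- by rewrite lc => /esym/eqP; rewrite (negPf (new _ _ n2 lc)).
- by rewrite lc => /eqP; rewrite (negPf (new _ _ n1 lc)).
by rewrite !keep_lp //; apply: inj.
Qed.

(** The contraction is built for the reduced matrix and carried back to the input [A] along the
    recorded column operations. *)
Lemma local_reduction_contraction : graded rgr cgr A ->
  exists h, contraction rgr cgr (rs_pos st) (rs_neg st) A h.
Proof.
move=> gA; have [[U [uU gU KU AU]] _ neg_pos pos_neg inj] := local_reduction_reduced.
have [|h] := triangular_contraction _ neg_pos pos_neg inj.
  by rewrite AU; apply: gradedM gA gU.
by rewrite AU => /(contraction_mulr uU gU KU); exists (U *m h).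
Qed.

End LocalReduction.

End Columns.

(** * Compression *)

Section Compression.
Variables (m n : nat) (rgr : 'I_m -> grade) (cgr : 'I_n -> grade).
Variables (rpos rneg : {set 'I_m}) (cpos cneg : {set 'I_n}).
Variable A : 'M['F_2]_(m, n).

Let lpiv := local_pivot rgr cgr.
Let step := compress_step rgr cgr rpos rneg cneg.

Hypothesis rpos_neg : forall i, i \in rpos ->
  exists2 c, c \in cneg & lpiv A c = Some i.

(* Rows in [rneg] are ignored because the algorithm clears their entries. *)
Definition reduced_col (c : 'I_n) (B : 'M['F_2]_(m, n)) : Prop :=
  exists y : 'cV['F_2]_n, proj (~: cneg) *m y = 0 /\
    forall i, i \notin rneg -> B i c = (A *m (delta_mx c 0 + y)) i 0.

(** Clearing an entry affects only a row that [reduced_col] ignores, and adding [c'] adds a unit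
    vector to [y]; both lower the largest local index in column [c]. *)
Lemma compress_iter c (B : 'M_(m, n)) : c \notin cneg ->
  (forall i, B i c = A i c) -> (forall i j, j \in cneg -> B i j = A i j) ->
  let B1 := iter m (step c) B in
  [/\ forall i j, j != c -> B1 i j = B i j, reduced_col c B1
    & forall i, i \in rpos :|: rneg -> B1 i c = 0].
Proof.
move=> cN Bc BN B1.
pose Q : pred 'I_m := mem (rpos :|: rneg).
pose P (B' : 'M_(m, n)) := (forall i j, j != c -> B' i j = B i j) /\ reduced_col c B'.
have P0 : P B.
  split=> //; exists 0; rewrite mulmx0; split=> // i _.
  by rewrite addr0 -colE mxE.
have lpP B' : P B' -> forall c' i, c' \in cneg ->
    (lpiv B' c' == Some i) = (lpiv A c' == Some i).
  move=> [keep _] c' i c'n; congr (_ == _); apply: eq_local_pivot => j.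
  by rewrite keep ?BN //; apply: contraNneq cN => <-.
have stepP B' : P B' -> (step c B' = B' /\ forall i, Q i -> B' i c = 0) \/
    (P (step c B') /\ (col_height Q (step c B') c < col_height Q B' c)%N).
  move=> PB'; have [keep [y [Ky yE]]] := PB'.
  rewrite /step /compress_step.
  case: pickP => [i /andP[/andP[B'i Qi] /forallP mx]|no]; last first.
    left; split=> // i Qi; apply/eqP/idPn => B'i.
    pose i0 := [arg max_(j > i | (B' j c != 0) && Q j) (j : nat)].
    have := no i0; rewrite /i0.
    case: arg_maxnP => [|j /andP[B'j Qj] mx]; first by rewrite B'i.
    rewrite B'j [_ \in _]Qj /= => /negP; case.
    by apply/forallP => j'; apply/implyP/mx.
  have {}mx i' : Q i' -> B' i' c != 0 -> (i' <= i)%N.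
    by move=> Qi' nz; move/implyP: (mx i'); apply; rewrite nz.
  right; case: ifP => [iN|/negP iN].
    split; last first.
      apply: (col_height_lt Qi B'i) => i' Qi'; rewrite mxE eqxx andbT.
      have [->|ii' nz] := eqVneq i' i; first by [].
      by rewrite ltn_neqAle ii' mx.
    split=> [j k kc|]; first by rewrite mxE (negPf kc) andbF keep.
    exists y; split=> // j jN; rewrite mxE eqxx andbT yE //.
    by have [ji|//] := eqVneq j i; rewrite ji iN in jN.
  have iP : i \in rpos by move: Qi; rewrite inE => /orP[|/iN].
  have [c0 c0n lc0] := rpos_neg iP.
  case: pickP => [c' /andP[c'n]|/(_ c0)]; last first.
    by rewrite c0n -/lpiv lpP // lc0 eqxx.
  rewrite -/lpiv => lc'; split; last first.
    by apply: (col_height_add_col Qi B'i mx); apply/eqP/lc'.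
  split=> [j k kc|]; first by rewrite mxE (negPf kc) keep.
  exists (y + delta_mx c' 0); split.
    rewrite mulmxDr Ky add0r; apply/matrixP => j k; rewrite proj_mul !mxE inE.
    by case: ifP => // jN; have [jc'|//] := eqVneq j c'; rewrite jc' c'n in jN.
  move=> j jN; rewrite mxE eqxx yE // [in RHS]addrA [in RHS]mulmxDr [RHS]mxE.
  congr (_ + _).
  by rewrite -colE mxE keep ?BN //; apply: contraNneq cN => <-.
have PB1 : P B1.
  apply: (@iter_invariant _ _ P) => // B' PB'.
  by case: (stepP _ PB') => [[->]|[]].
split; [exact: PB1.1|exact: PB1.2|].
(* The step is known to decrease only under the invariant [P], so the induction on the fuel carries
   [P] along. *)
have fixB1 : forall k B', P B' -> (col_height Q B' c <= k)%N ->
    forall i, Q i -> iter k (step c) B' i c = 0.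
  elim=> [|k IH] B' PB' le; case: (stepP _ PB') => [[fixB' z]|[PsB' lt]].
  - exact: z.
  - by have := leq_trans lt le; rewrite ltn0.
  - by rewrite iter_fix.
  by rewrite iterSr; apply: IH => //; rewrite -ltnS; apply: leq_trans lt _.
by apply: fixB1 => //; apply: col_height_le.
Qed.

Lemma compressP c : c \notin cpos :|: cneg ->
  let Z := compress rgr cgr rpos rneg cpos cneg A in
  reduced_col c Z /\ forall i, i \in rpos :|: rneg -> Z i c = 0.
Proof.
move=> cG; rewrite /compress.
(* Global columns are never added to others, so visiting one leaves all other columns as they
   were. *)
pose G : {set 'I_n} := ~: (cpos :|: cneg).
suff H s : uniq s -> {subset s <= G} ->
    let Z := foldl (fun A' c => iter m (step c) A') A s in
    (forall i j, j \notin s -> Z i j = A i j) /\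
    forall c', c' \in s -> reduced_col c' Z /\
      forall i, i \in rpos :|: rneg -> Z i c' = 0.
  apply: (proj2 (H _ _ _)).
  - by rewrite filter_uniq ?enum_uniq.
  - by move=> c'; rewrite mem_filter !inE => /andP[].
  by rewrite mem_filter cG mem_enum.
elim/last_ind: s => [|s d IH]; first by [].
rewrite rcons_uniq foldl_rcons => /andP[ds us] sub.
have [|keep good] := IH us.
  by move=> c' c's; apply: sub; rewrite mem_rcons inE c's orbT.
set Z := foldl _ _ _ in keep good *.
have dG : d \in G by apply: sub; rewrite mem_rcons mem_head.
have GN j : j \in G -> j \notin cneg by rewrite !inE negb_or => /andP[].
have [|||keep1 red1 zero1] := @compress_iter d Z.
- exact: GN.
- by move=> i; apply: keep.
- move=> i j jn; apply: keep; apply/negP => js.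
  have /sub/GN : j \in rcons s d by rewrite mem_rcons inE js orbT.
  by rewrite jn.
split=> [i j|c'].
  by rewrite mem_rcons inE negb_or => /andP[jd js]; rewrite keep1 ?keep.
rewrite mem_rcons inE; have [->//|c'd /= c's] := eqVneq c' d.
have [[y [Ky yE]] z] := good _ c's; split=> [|i ip]; last by rewrite keep1 ?z.
by exists y; split=> // i iN; rewrite keep1 ?yE.
Qed.

End Compression.

Section Schur.
Variables (m n : nat) (rgr : 'I_m -> grade) (cgr : 'I_n -> grade).
Variables (rneg : {set 'I_m}) (cpos : {set 'I_n}) (A : 'M['F_2]_(m, n)).

(** The compressed column is [A w] off the rows in [rneg], with [w] equal to the unit vector at [c]
    outside the negative coordinates. Since [A w] vanishes on positive rows, [h A w = 0], which
    forces [w = (1 - h A) e_c] whatever additions were made. *)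
Lemma compress_schur h i c :
  let st := local_reduction rgr cgr cpos A in
  [disjoint rs_pos st & rneg] ->
  contraction rgr cgr (rs_pos st) (rs_neg st) A h ->
  i \notin rs_pos st :|: rneg -> c \notin cpos :|: rs_neg st ->
  compress rgr cgr (rs_pos st) rneg cpos (rs_neg st) (rs_mx st) i c
  = (A - A *m h *m A) i c.
Proof.
move=> st dis /and5P[_ /eqP nh /eqP hp _ /eqP hn] iG cG.
have [[U [uU gU KU AU]] _ _ pos_neg _] := local_reduction_reduced rgr cgr cpos A.
rewrite -/st in KU AU pos_neg.
have [[y [Ky yE]] z] := compressP rneg pos_neg cG.
(* [w] combines the column additions of both phases, expressed in the columns of the input [A]. *)
pose w : 'cV_n := U *m (delta_mx c 0 + y).
have AwE j : j \notin rneg ->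
    compress rgr cgr (rs_pos st) rneg cpos (rs_neg st) (rs_mx st) j c
    = (A *m w) j 0.
  by move=> jN; rewrite yE // AU /w mulmxA.
have Kw : proj (~: rs_neg st) *m w = delta_mx c 0.
  rewrite mulmxA KU mulmxDr Ky addr0; apply/matrixP => j k.
  rewrite proj_mul !mxE inE; have [->|] := eqVneq j c; last by rewrite if_same.
  by move: cG; rewrite inE negb_or => /andP[_ ->].
(* Positive rows are not negative, so here the zeros left by the compression are true entries of
   [A w]. *)
have pAw : proj (rs_pos st) *m (A *m w) = 0.
  apply/matrixP => j k; rewrite proj_mul [k]ord1 [RHS]mxE; case: ifP => // jp.
  by rewrite -AwE ?z ?inE ?jp // (disjointFr dis jp).
have wE : w = delta_mx c 0 - h *m A *m delta_mx c 0.
  have wD : w = delta_mx c 0 + proj (rs_neg st) *m w.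
    by rewrite -Kw projC mulmxBl mul1mx subrK.
  have : h *m (A *m w) = 0 by rewrite -hp -mulmxA pAw mulmx0.
  rewrite mulmxA {1}wD mulmxDr mulmxA hn => /eqP.
  by rewrite addrC addr_eq0 => /eqP nw; rewrite {1}wD nw.
rewrite AwE; last by move: iG; rewrite inE negb_or => /andP[].
rewrite wE -{1}[delta_mx c 0]mul1mx -mulmxBl mulmxA mulmxBr mulmx1 mulmxA.
by rewrite -colE !mxE.
Qed.

End Schur.

(** * Retraction onto the global generators *)

Section Retraction.
Variables (R : comNzRingType) (r g : nat -> nat).
Variables (d : forall n, 'M[R]_(r n, r n.+1)) (h : forall n, 'M[R]_(r n.+1, r n)).
Variables (inj : forall n, 'M[R]_(r n, g n)) (res : forall n, 'M[R]_(g n, r n)).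
Variables (eP eN : forall n, 'M[R]_(r n)).
Hypotheses (dd : forall n, d n *m d n.+1 = 0) (hh : forall n, h n.+1 *m h n = 0)
  (hdh : forall n, h n *m d n *m h n = h n).
Hypotheses (h_inj : forall n, h n *m inj n = 0)
  (res_h : forall n, res n.+1 *m h n = 0) (resK : forall n, res n *m inj n = 1%:M).
Hypotheses (inj_res : forall n, inj n *m res n = 1%:M - eP n - eN n)
  (ePdh : forall n, eP n *m d n *m h n = eP n) (eN0 : eN 0 = 0)
  (hdeN : forall n, h n *m d n *m eN n.+1 = eN n.+1).

(** The term [h d] of the homotopy formula, absent in degree 0. *)
Definition htpy_bd n : 'M[R]_(r n) :=
  if n is n'.+1 return 'M_(r n) then h n' *m d n' else 0.

Definition retr n : 'M[R]_(r n) := 1%:M - d n *m h n - htpy_bd n.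

Lemma htpy_bd_bd n : htpy_bd n *m d n = 0.
Proof. by case: n => [|n]; rewrite ?mul0mx //= -mulmxA dd mulmx0. Qed.

Lemma h_htpy_bd n : h n *m htpy_bd n = 0.
Proof. by case: n => [|n]; rewrite ?mulmx0 //= mulmxA hh mul0mx. Qed.

Lemma htpy_bd_idem n : htpy_bd n *m htpy_bd n = htpy_bd n.
Proof. by case: n => [|n]; rewrite ?mulmx0 //= mulmxA hdh. Qed.

(** With [d_retr] this shows that [retr] is a chain map, and identifies the common value as the
    Schur complement. *)
Lemma retr_d n : retr n *m d n = d n - d n *m h n *m d n.
Proof. by rewrite !mulmxBl mul1mx htpy_bd_bd subr0. Qed.

Lemma d_retr n : d n *m retr n.+1 = d n - d n *m h n *m d n.
Proof. by rewrite !mulmxBr mulmx1 !mulmxA dd mul0mx subr0. Qed.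

(** [retr] annihilates [d h] and [h d] from the left, so only the identity in the second factor
    contributes. *)
Lemma retr_idem n : retr n *m retr n = retr n.
Proof.
have -> : retr n *m retr n = retr n - retr n *m d n *m h n - retr n *m htpy_bd n.
  by rewrite {2}/retr !mulmxBr mulmx1 mulmxA.
rewrite retr_d mulmxBl -!mulmxA (mulmxA (h n)) hdh subrr subr0.
have -> : retr n *m htpy_bd n = 0; last exact: subr0.
by rewrite !mulmxBl mul1mx htpy_bd_idem -mulmxA h_htpy_bd mulmx0 subr0 subrr.
Qed.

(** On negative coordinates [h d] is the identity, and then [d h] vanishes because [h h = 0]. *)
Lemma retr_eN n : retr n *m eN n = 0.
Proof.
case: n => [|n]; first by rewrite eN0 mulmx0.
rewrite !mulmxBl mul1mx /= hdeN -{2}hdeN !mulmxA -(mulmxA _ (h n.+1)) hh.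
by rewrite mulmx0 !mul0mx subr0 subrr.
Qed.

Lemma eP_retr n : eP n *m retr n = 0.
Proof.
rewrite !mulmxBr mulmx1 mulmxA ePdh subrr sub0r -(ePdh n).
by rewrite -(mulmxA (eP n *m d n)) h_htpy_bd mulmx0 oppr0.
Qed.

(** [inj res] differs from 1 by the local projections, which are killed by [retr] on one side or the
    other. *)
Lemma retr_inj_res n : retr n *m inj n *m (res n *m retr n) = retr n.
Proof.
move: (retr n) (retr_eN n) (eP_retr n) (retr_idem n) => p peN ePp pp.
rewrite mulmxA -(mulmxA p) inj_res !mulmxBr mulmx1 peN subr0.
by rewrite mulmxBl -mulmxA ePp mulmx0 subr0 pp.
Qed.

Lemma res_htpy_bd n : res n *m htpy_bd n = 0.
Proof. by case: n => [|n]; rewrite ?mulmx0 //= mulmxA res_h mul0mx. Qed.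

(** [res] kills the image of [h] and [h] kills the image of [inj], so only the identity term of
    [retr] survives. *)
Lemma res_retr_inj n : res n *m retr n *m (retr n *m inj n) = 1%:M.
Proof.
rewrite mulmxA -(mulmxA (res n)) retr_idem /retr !mulmxBr res_htpy_bd subr0 mulmx1.
by rewrite mulmxBl resK -!mulmxA h_inj !mulmx0 subr0.
Qed.

End Retraction.

Lemma colsub_rowsub_enum_val n (S : {set 'I_n}) :
  colsub (@enum_val _ (mem S)) 1%:M *m rowsub (@enum_val _ (mem S)) 1%:M = proj S.
Proof.
apply/matrixP => i j; rewrite !mxE.
under eq_bigr => k _ do rewrite !mxE.
rewrite -(big_enum_val (fun x : 'I_n => (i == x)%:R * (x == j)%:R : 'F_2)).
rewrite big_mkcond (bigD1 i) //= big1 => [|k ki].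
  by rewrite eqxx mul1r addr0; case: (i \in S); rewrite ?andbT ?andbF.
by rewrite eq_sym (negPf ki) mul0r if_same.
Qed.

(** * The homotopy equivalence for the output of the algorithm *)

Section MultiChunkHomotopy.
Variables (F : chain_complex) (D : graded_matrices) (B : ordered_bases F D).
Variable N : nat.
Arguments B : clear implicits.
Hypotheses (F_bounded : forall n, (N < n)%N -> pmod_is_zero (F n))
           (rB : represented_by B).

(** The empty set generates a zero module, so minimality leaves no generator. *)
Lemma rank_bounded n : (N < n)%N -> 'I_(gm_rank D n) -> False.
Proof.
move=> /F_bounded F0 i; case: rB => _ /(_ n)[_ mB] _ _.
suff /mB/setP/(_ i) : generates (B n) set0 by rewrite !inE.
by move=> z x; exists (fun=> 0); rewrite [x]F0 big1 // => j _; rewrite scale0r.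
Qed.

(** For [n < N] one unit of fuel unfolds; from [N] on both sides are empty, as there are no columns
    of degree [n.+1] to have pivots. *)
Lemma positivesE n : positives N D n = rs_pos (phase1 N D n).
Proof.
have [nN|Nn] := ltnP n N; first by rewrite {1}/positives -subnSK.
have /eqP Nn0 : (N - n == 0)%N by rewrite subn_eq0.
rewrite {1}/positives Nn0.
have [_ _ _ pos_neg _] := local_reduction_reduced (@gm_gr D n) (@gm_gr D n.+1)
  (positives N D n.+1) (gm_bd D n).
apply/esym/setP => i; rewrite [RHS]inE; apply/negP => /pos_neg[c _ _].
exact: (@rank_bounded n.+1).
Qed.

Lemma positives_negatives n : [disjoint positives N D n & negatives N D n].
Proof.
rewrite disjoint_sym disjoint_subset; apply/subsetP => c; rewrite [_ \in _]/=.
case: n c => [|n] c; first by rewrite inE.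
have [_ dis _ _ _] := local_reduction_reduced (@gm_gr D n) (@gm_gr D n.+1)
  (positives N D n.+1) (gm_bd D n).
exact: dis.
Qed.

Fact contraction_exists n : exists h, contraction (@gm_gr D n) (@gm_gr D n.+1)
  (positives N D n) (negatives N D n.+1) (gm_bd D n) h.
Proof.
rewrite positivesE; apply: local_reduction_contraction.
exact: represented_graded rB n.
Qed.

End MultiChunkHomotopy.

(* The graded matrices returned by the algorithm do represent a chain complex
   of finitely generated free modules, and every complex that they represent
   is homotopy equivalent to the input. *)
Theorem theorem3p3 (F : chain_complex) (D : graded_matrices)
    (B : ordered_bases F D) (N : nat)
    (F_bounded : forall n, (N < n)%N -> pmod_is_zero (F n))
    (D_compat : order_compatible D)
    (F_rep : represented_by B) :
  (exists (G : chain_complex) (C : ordered_bases G (multi_chunk N D)),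
      represented_by C) /\
  (forall (G : chain_complex) (C : ordered_bases G (multi_chunk N D)),
      represented_by C -> homotopy_equivalent F G).
Proof.
pose r n := gm_rank D n; pose d n := gm_bd D n.
pose h n : 'M['F_2]_(r n.+1, r n) := xchoose (contraction_exists F_bounded F_rep n).
pose eP n := proj (positives N D n); pose eN n := proj (negatives N D n).
have hP n := xchooseP (contraction_exists F_bounded F_rep n).
have gh n : graded (@gm_gr D n.+1) (@gm_gr D n) (h n) by case/and5P: (hP n).
have eNh n : eN n.+1 *m h n = h n by case/and5P: (hP n) => _ /eqP.
have heP n : h n *m eP n = h n by case/and5P: (hP n) => _ _ /eqP.
have ePdh n : eP n *m d n *m h n = eP n by case/and5P: (hP n) => _ _ _ /eqP.
have hdeN n : h n *m d n *m eN n.+1 = eN n.+1 by case/and5P: (hP n) => _ _ _ _ /eqP.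
have gd n : graded (@gm_gr D n) (@gm_gr D n.+1) (d n) := represented_graded F_rep n.
have dd n : d n *m d n.+1 = 0 := represented_bd_bd F_rep n.
have ePeN n : eP n *m eN n = 0.
  apply/matrixP => i j; rewrite proj_mul !mxE; case: ifP => // ip.
  by rewrite (disjointFr (positives_negatives D N n) ip) andbF.
(* The image of [h n] lies in negative coordinates, while [h n.+1] reads only positive ones. *)
have hh n : h n.+1 *m h n = 0.
  by rewrite -heP -mulmxA -(eNh n) (mulmxA (eP _)) ePeN mul0mx mulmx0.
have hdh n : h n *m d n *m h n = h n.
  by rewrite -{1}heP -!mulmxA (mulmxA (eP n)) ePdh heP.
pose g n := #|globals N D n|.
pose inj n : 'M['F_2]_(r n, g n) := colsub enum_val 1%:M.
pose res n : 'M['F_2]_(g n, r n) := rowsub enum_val 1%:M.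
have globalP n (k : 'I_(g n)) :
    enum_val k \notin positives N D n /\ enum_val k \notin negatives N D n.
  by have := enum_valP k; rewrite !inE negb_or => /andP.
have h_inj n : h n *m inj n = 0.
  rewrite -heP mulmx_colsub mulmx1; apply/matrixP => i k.
  by rewrite mxE mul_proj (negPf (globalP n k).1) mxE.
have res_h n : res n.+1 *m h n = 0.
  rewrite -eNh mul_rowsub_mx mul1mx; apply/matrixP => k i.
  by rewrite mxE proj_mul (negPf (globalP _ k).2) mxE.
have resK n : res n *m inj n = 1%:M.
  rewrite mul_rowsub_mx mul1mx; apply/matrixP => k l.
  by rewrite !mxE (inj_eq enum_val_inj).
have inj_res n : inj n *m res n = 1%:M - eP n - eN n.
  rewrite colsub_rowsub_enum_val projC -addrA -opprD; congr (_ - _).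
  apply/matrixP => i j; rewrite !mxE inE.
  case: (i == j); rewrite ?addr0 //=.
  have [ip|_] := boolP (i \in positives N D n); last by rewrite add0r.
  by rewrite (disjointFr (positives_negatives D N n) ip) addr0.
have eN0 : eN 0 = 0 by apply/matrixP => i j; rewrite !mxE inE andbF.
(* Phase III keeps exactly the entries on which [compress_schur] identifies the Schur complement. *)
have bdE n : gm_bd (multi_chunk N D) n
    = mxsub enum_val enum_val (d n - d n *m h n *m d n).
  apply/matrixP => k l; rewrite 2!mxE.
  have := @compress_schur _ _ (@gm_gr D n) (@gm_gr D n.+1) (negatives N D n)
    (positives N D n.+1) (gm_bd D n) (h n) (enum_val k) (enum_val l).
  cbv zeta; rewrite -/(phase1 N D n) -(positivesE F_bounded F_rep n); apply.
  - exact: positives_negatives.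
  - exact: hP.
  - by have := enum_valP k; rewrite inE.
  by have := enum_valP l; rewrite inE.
pose p := retr d h.
have pd n : p n *m d n = d n - d n *m h n *m d n by apply: retr_d.
have dp n : d n *m p n.+1 = d n - d n *m h n *m d n by apply: d_retr.
have pK n : p n *m inj n *m (res n *m p n) = p n.
  exact: (retr_inj_res dd hh hdh inj_res ePdh eN0 hdeN).
have inj_pK n : res n *m p n *m (p n *m inj n) = 1%:M.
  exact: (res_retr_inj dd hh hdh h_inj res_h resK).
have p0 : p 0 = 1%:M - d 0 *m h 0 by rewrite /p /retr /= subr0.
have pS n : p n.+1 = 1%:M - d n.+1 *m h n.+1 - h n *m d n by [].
have gp n : graded (@gm_gr D n) (@gm_gr D n) (p n).
  case: n => [|n]; rewrite ?p0 ?pS; last apply: gradedB (gradedM (gh _) (gd _)).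
    exact: gradedB (graded1 _) (gradedM (gd _) (gh _)).
  exact: gradedB (graded1 _) (gradedM (gd _) (gh _)).
clearbody p.
have comm n : p n *m d n = d n *m p n.+1 by rewrite pd dp.
have dE n : gm_bd (multi_chunk N D) n = res n *m (p n *m d n) *m inj n.+1.
  by rewrite bdE pd mul_rowsub_mx mul1mx mulmx_colsub mulmx1 mxsubcr.
have gE : graded_bd (multi_chunk N D).
  move=> n; rewrite bdE; apply: graded_sub.
  exact: gradedB (gd n) (gradedM (gradedM (gd n) (gh n)) (gd n)).
(* Replacing [p inj res p] by [p] between two output boundaries and moving [p] past [d n] brings
   [d n] next to [d n.+1]. *)
have EE n : gm_bd (multi_chunk N D) n *m gm_bd (multi_chunk N D) n.+1 = 0.
  have -> : gm_bd (multi_chunk N D) n *m gm_bd (multi_chunk N D) n.+1 =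
      res n *m d n *m (p n.+1 *m inj n.+1 *m (res n.+1 *m p n.+1)) *m d n.+1 *m inj n.+2.
    by rewrite !dE comm !mulmxA.
  by rewrite pK -(mulmxA (res n)) -comm !mulmxA -(mulmxA _ (d n)) dd mulmx0 mul0mx.
have gres n : graded (@gm_gr (multi_chunk N D) n) (@gm_gr D n) (res n).
  exact: (graded_sub enum_val id (graded1 (@gm_gr D n))).
have ginj n : graded (@gm_gr D n) (@gm_gr (multi_chunk N D) n) (inj n).
  exact: (graded_sub id enum_val (graded1 (@gm_gr D n))).
split; first exact: represented_exists.
move=> G C G_rep.
(* The homotopy is [- h] because [psi phi = p = 1 - d h - h d]. *)
apply: (@homotopy_equivalent_mx _ _ _ _ _ _ F_rep G_rep
  (fun n => res n *m p n) (fun n => p n *m inj n) (fun n => - h n)) => [n|n|n|n|n|n||n].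
- exact: gradedM (gres n) (gp n).
- exact: gradedM (gp n) (ginj n).
- exact: gradedN.
- have -> : gm_bd (multi_chunk N D) n *m (res n.+1 *m p n.+1)
    = res n *m d n *m (p n.+1 *m inj n.+1 *m (res n.+1 *m p n.+1)).
    by rewrite dE comm !mulmxA.
  by rewrite pK -!mulmxA comm.
- have -> : p n *m inj n *m gm_bd (multi_chunk N D) n
    = p n *m inj n *m (res n *m p n) *m d n *m inj n.+1 by rewrite dE !mulmxA.
  by rewrite pK comm !mulmxA.
- exact: inj_pK.
- by rewrite pK p0 mulmxN.
by rewrite pK pS mulmxN mulNmx.
Qed.
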